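(* Let $\Gamma$ be a discrete subgroup of $\mathrm{GL}_2(F_\infty)$ with $\det(\Gamma)\subset\mathcal{O}_\infty^\times$, and let $$P(z)=\sum_{[\gamma]\in H\backslash\Gamma}(\det\gamma)^l\prod_{i=1}^r\gamma^*s(z;a_i,b_i)^{k_i}$$ be a Poincaré series for $\Gamma$ with $r\geqslant 2$ satisfying condition (P). Assume that the geodesics $[a_i\to b_i]$ for $1\leqslant i\leqslant r$ intersect at a single vertex, $\bigcap_{i=1}^r[a_i\to b_i]=\{v\}$ with $v$ a vertex of $\mathcal{T}$, and that $\Gamma_v\subseteq H$, where $\Gamma_v=\{\gamma\in\Gamma:\gamma v=v\}$. Let $z\in\Omega$ and $p=\lambda(z)$. Then $\mathrm{ord}_z(P)=0$ if $z$ lies in the $\Gamma$-orbit of $\Omega_v$, and $\mathrm{ord}_z(P)\geqslant t_p>0$ otherwise, where $t_p=1$ if $p$ is a vertex of $\mathcal{T}$ and $t_p$ is the distance from $p$ to the set of vertices of $\mathcal{T}$ otherwise. In particular, $P$ is not identically zero.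
   Context: $q=p^e$ is an odd prime power (here $p$ is the characteristic), $F=\mathbb{F}_q(T)$, $\pi=1/T$, $F_\infty=\mathbb{F}_q((\pi))$, $\mathcal{O}_\infty=\mathbb{F}_q[[\pi]]$; $\mathbb{C}_\infty$ is the completion of an algebraic closure of $F_\infty$; $\mathrm{ord}$ is the valuation with $\mathrm{ord}(\pi)=1$, extended to $\mathbb{C}_\infty$, and $|x|=q^{-\mathrm{ord}(x)}$. $\Omega=\mathbb{C}_\infty\setminus F_\infty$ is the Drinfeld half-plane, with $\mathrm{GL}_2(F_\infty)$ acting by linear fractional transformations; $|z|_i=\inf\{|z-x|:x\in F_\infty\}$. Tree. $\mathcal{T}$ is the Bruhat–Tits tree of $\mathrm{PGL}_2(F_\infty)$: vertices are homothety classes $[L]$ of rank-two $\mathcal{O}_\infty$-lattices in the row space $F_\infty^2$, adjacent if they have representatives with $\pi L\subset L'\subset L$ (strict); $\gamma[L]=[L\gamma^{-1}]$. $v_n=[\pi^n\mathcal{O}_\infty f_1+\mathcal{O}_\infty f_2]$. Ends of $\mathcal{T}$ are identified $\mathrm{GL}_2(F_\infty)$-equivariantly with $\mathbb{P}^1(F_\infty)$, $(v_n)_{n\geqslant 0}$ representing $\infty$ and $(v_{-n})_{n\geqslant0}$ representing $0$. $[a\to b]$ is the geodesic from $a$ to $b$, viewed in the geometric realization $\mathcal{T}(\mathbb{R})$ (edges of length 1, path metric $d$). The building map $\lambda\colon\Omega\to\mathcal{T}(\mathbb{R})$ is the unique $\mathrm{GL}_2(F_\infty)$-equivariant map with $\lambda^{-1}((1-t)v_0+tv_{-1})=\{z\in\mathbb{C}_\infty:|z|=|z|_i=q^{-t}\}$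 for $t\in[0,1]\cap\mathbb{Q}$; its image is the set of points with rational barycentric coordinates. $\Omega_v=\lambda^{-1}(v)$. Forms. For a $k$-form $\omega=g(z)(\mathrm{d}z)^k$ on $\Omega$, $\mathrm{ord}_z(\omega)=\mathrm{ord}\,g(z)-k\log_q|z|_i$. $s(z;a,b)=\left(\frac1{z-b}-\frac1{z-a}\right)\mathrm{d}z$ (with $\frac{1}{z-\infty}=0$), and $\gamma^*s(z;a,b)=\left(\frac1{\gamma z-b}-\frac1{\gamma z-a}\right)\mathrm{d}(\gamma z)$, which equals $s(z;\gamma^{-1}a,\gamma^{-1}b)$. Poincaré series data. $k_1,\dots,k_r\geqslant1$, $k=\sum k_i$, $l\in\mathbb{Z}$, $H\leqslant\Gamma$ with $\det(h)^l=1$ for all $h\in H$, and $a_i,b_i\in\mathbb{P}^1(F_\infty)$ with $a_i\ne b_i$, $\{a_i,b_i\}\ne\{a_j,b_j\}$ for $i\neq j$, and every $h\in H$ fixing all $a_i,b_i$. Condition (P): for all vertices $v$ of $\mathcal{T}$ and all $N\geqslant0$ the set $\{[\gamma]\in H\backslash\Gamma: d(\gamma v,[a_i\to b_i])\leqslant N\ \forall i\}$ is finite. Under (P) the series converges locally uniformly on $\Omega$ to a holomorphic $k$-form. *)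

(* Defs.v *)
From HB Require Import structures.
From mathcomp Require Import all_boot all_order all_algebra.
From mathcomp Require Import all_classical all_reals all_analysis.
Set Implicit Arguments.
Unset Strict Implicit.
Unset Printing Implicit Defensive.
Import Order.TTheory GRing.Theory Num.Theory.
Local Open Scope classical_set_scope.
Local Open Scope ring_scope.

Record pseries (K : Type) := PSeries { pcoef : nat -> K }.

HB.instance Definition _ (K : Type) := gen_eqMixin (pseries K).
HB.instance Definition _ (K : Type) := gen_choiceMixin (pseries K).

Section PowerSeries.
Variable K : fieldType.
Implicit Types f g h : pseries K.

Definition ps_zero : pseries K := PSeries (fun=> 0).
Definition ps_one : pseries K := PSeries (fun n => (n == 0%N)%:R).
Definition ps_opp f := PSeries (fun n => - pcoef f n).
Definition ps_add f g := PSeries (fun n => pcoef f n + pcoef g n).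
Definition ps_mul f g :=
  PSeries (fun n => \sum_(i < n.+1) pcoef f i * pcoef g (n - i)%N).

Lemma ps_ext f g : pcoef f =1 pcoef g -> f = g.
Proof. by case: f g => f [g] /= /funext ->. Qed.

Fact ps_addA : associative ps_add.
Proof. by move=> f g h; apply: ps_ext => n /=; rewrite addrA. Qed.
Fact ps_addC : commutative ps_add.
Proof. by move=> f g; apply: ps_ext => n /=; rewrite addrC. Qed.
Fact ps_add0 : left_id ps_zero ps_add.
Proof. by move=> f; apply: ps_ext => n /=; rewrite add0r. Qed.
Fact ps_addN : left_inverse ps_zero ps_opp ps_add.
Proof. by move=> f; apply: ps_ext => n /=; rewrite addNr. Qed.

HB.instance Definition _ :=
  GRing.isZmodule.Build (pseries K) ps_addA ps_addC ps_add0 ps_addN.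

Definition ps_trunc m f : {poly K} := \poly_(i < m.+1) pcoef f i.

Lemma coef_ps_trunc m f i : (i <= m)%N -> (ps_trunc m f)`_i = pcoef f i.
Proof. by move=> im; rewrite coef_poly ltnS im. Qed.

Lemma coef_ps_mul m f g n : (n <= m)%N ->
  (ps_trunc m f * ps_trunc m g)`_n = pcoef (ps_mul f g) n.
Proof.
move=> nm; rewrite coefM; apply: eq_bigr => i _.
rewrite !coef_ps_trunc //; first exact: leq_trans (leq_subr _ _) nm.
by apply: leq_trans nm; rewrite -ltnS.
Qed.

Fact ps_mulC : commutative ps_mul.
Proof.
move=> f g; apply: ps_ext => n.
by rewrite -(coef_ps_mul f g (leqnn n)) mulrC coef_ps_mul.
Qed.

Lemma ps_mul3 f g h n : pcoef (ps_mul f (ps_mul g h)) n =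
  (ps_trunc n f * (ps_trunc n g * ps_trunc n h))`_n.
Proof.
rewrite coefM; apply: eq_bigr => i _; rewrite coef_ps_trunc -1?ltnS //.
by rewrite coef_ps_mul ?leq_subr.
Qed.

Fact ps_mulA : associative ps_mul.
Proof.
move=> f g h; apply: ps_ext => n.
by rewrite (ps_mulC (ps_mul f g)) !ps_mul3 mulrA mulrC.
Qed.

Fact ps_mul1 : left_id ps_one ps_mul.
Proof.
move=> f; apply: ps_ext => n /=; rewrite big_ord_recl /= mul1r subn0.
by rewrite big1 ?addr0 // => i _; rewrite mul0r.
Qed.

Fact ps_mulDl : left_distributive ps_mul ps_add.
Proof.
move=> f g h; apply: ps_ext => n /=.
by rewrite -big_split; apply: eq_bigr => i _; rewrite mulrDl.
Qed.

Fact ps_one_neq0 : ps_one != 0.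
Proof.
apply/eqP => /(congr1 (fun f => pcoef f 0)) /= /eqP.
by rewrite oner_eq0.
Qed.

HB.instance Definition _ := GRing.Zmodule_isComNzRing.Build (pseries K)
  ps_mulA ps_mulC ps_mul1 ps_mulDl ps_one_neq0.

Definition ps_unit : {pred pseries K} := fun f => `[< exists g, g * f = 1 >].
Definition ps_inv f := if f \in ps_unit then xget f [set g | g * f = 1] else f.

Fact ps_mulV : {in ps_unit, left_inverse 1 ps_inv *%R}.
Proof.
move=> f uf; rewrite /ps_inv uf; move/asboolP: uf => [g gf].
by case: xgetP => [h _ //|/(_ g)]; rewrite /= gf.
Qed.
Fact ps_unitP f g : g * f = 1 -> ps_unit f.
Proof. by move=> gf; apply/asboolP; exists g. Qed.
Fact ps_inv_out : {in [predC ps_unit], ps_inv =1 id}.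
Proof. by move=> f /negbTE nf; rewrite /ps_inv nf. Qed.

HB.instance Definition _ := GRing.ComNzRing_hasMulInverse.Build (pseries K)
  ps_mulV ps_unitP ps_inv_out.

Lemma ps_lead f : f != 0 ->
  exists2 n, pcoef f n != 0 & forall i, (i < n)%N -> pcoef f i = 0.
Proof.
move=> f0; have ex : exists n, pcoef f n != 0.
  apply: contrapT => nex; case/eqP: f0; apply: ps_ext => n.
  by apply/eqP/negP => /negP fn; apply: nex; exists n.
case: (ex_minnP ex) => n fn min_n; exists n => // i lt_in.
apply/eqP; apply: contraTT lt_in => /min_n.
by rewrite -leqNgt.
Qed.

Fact ps_integral : GRing.integral_domain_axiom (pseries K).
Proof.
move=> f g fg0; apply: contrapT => /negP; rewrite negb_or => /andP[].
move=> /ps_lead[m fm lowf] /ps_lead[n gn lowg].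
have := congr1 (fun h => pcoef h (m + n)%N) fg0 => /=.
have mlt : (m < (m + n).+1)%N by rewrite ltnS leq_addr.
rewrite (bigD1 (Ordinal mlt)) //= addKn big1 ?addr0 => [/eqP|i neq_im].
  by rewrite mulf_eq0 (negbTE fm) (negbTE gn).
case: (ltngtP i m) => [lt_im|lt_mi|eq_im].
- by rewrite lowf ?mul0r.
- by rewrite lowg ?mulr0 // ltn_subLR ?ltn_add2r // -ltnS ltn_ord.
- by case/eqP: neq_im; apply: val_inj.
Qed.

HB.instance Definition _ :=
  GRing.ComUnitRing_isIntegral.Build (pseries K) ps_integral.

Definition ps_X : pseries K := PSeries (fun n => (n == 1%N)%:R).

(** The field K((pi)) of formal Laurent series, as the fraction field of
    K[[pi]]; [Oinf] is K[[pi]] inside it. *)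
Definition Finf := {fraction (pseries K)}.
HB.instance Definition _ := GRing.Field.on Finf.

Definition ps_to_F (f : pseries K) : Finf := tofrac f.
Definition Oinf : set Finf := range ps_to_F.
Definition Oinf_units : set Finf :=
  [set ps_to_F f | f in [set f | f \is a GRing.unit]].
Definition piF : Finf := ps_to_F ps_X.

End PowerSeries.

(** A completion of an algebraic closure of F = K((pi)): a complete valued
    extension of F in which the elements algebraic over F form an
    algebraically closed dense subfield.  Any two such extensions are
    isomorphic as valued extensions of F. *)
Record Cinfty (R : realType) (K : fieldType) := MkCinfty {
  Cinf_field :> fieldType;
  emb : {rmorphism Finf K -> Cinf_field};
  ord : Cinf_field -> \bar R;
  ord_neqNy : forall x, ord x <> -oo%E;
  ord_eqy : forall x, ord x = +oo%E <-> x = 0;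
  ordM : forall x y, ord (x * y) = (ord x + ord y)%E;
  ordD : forall x y, (Order.min (ord x) (ord y) <= ord (x + y))%E;
  ord_series : forall (f : pseries K) (n : nat),
    pcoef f n != 0 -> (forall i, (i < n)%N -> pcoef f i = 0) ->
    ord (emb (ps_to_F f)) = n%:R%:E;
  alg_closed : forall p : {poly Cinf_field}, (1 < size p)%N ->
    (forall i, algebraicOver emb p`_i) ->
    exists2 x, algebraicOver emb x & root p x;
  alg_dense : forall (x : Cinf_field) (M : R),
    exists2 y, algebraicOver emb y & (M%:E <= ord (x - y))%E;
  ord_complete : forall u : nat -> Cinf_field,
    (forall M : R, exists N, forall m n, (N <= m)%N -> (N <= n)%N ->
      (M%:E <= ord (u m - u n))%E) ->
    exists x, forall M : R, exists N, forall n, (N <= n)%N ->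
      (M%:E <= ord (u n - x))%E
}.

Section Drinfeld.
Variables (R : realType) (K : finFieldType) (C : Cinfty R K).

Local Notation F := (Finf K).
Local Notation q := (#|{: K}|%:R : R).
Local Notation "x %:C" := (@emb R K C x) (at level 1, format "x %:C").

Definition absC (x : C) : R := if x == 0 then 0 else q `^ (- fine (ord x)).

(** The imaginary absolute value |z|_i. *)
Definition absi (z : C) : R := inf [set absC (z - x%:C) | x in [set: F]].

Definition logq (y : R) : R := ln y / ln q.

Definition Omega : set C := ~` [set x%:C | x in [set: F]].

Definition GL2 : set 'M[F]_2 := [set g | g \in unitmx].

Definition is_subgroup (G : set 'M[F]_2) : Prop :=
  [/\ G `<=` GL2, G 1%:M, (forall g h, G g -> G h -> G (g *m h)) &
      forall g, G g -> G (invmx g)].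

(** Discreteness for the topology of GL_2(F) as a subspace of F^4. *)
Definition is_discrete (G : set 'M[F]_2) : Prop :=
  forall g, G g -> exists2 e : R, 0 < e &
    forall h, G h -> (forall i j, absC (h i j - g i j)%:C < e) -> h = g.

Definition mobC (g : 'M[F]_2) (z : C) : C :=
  ((g 0 0)%:C * z + (g 0 1)%:C) / ((g 1 0)%:C * z + (g 1 1)%:C).

(** The derivative d(gz)/dz of z |-> gz. *)
Definition dmobC (g : 'M[F]_2) (z : C) : C :=
  (\det g)%:C / ((g 1 0)%:C * z + (g 1 1)%:C) ^+ 2.

(** P^1(F), with [None] the point at infinity. *)
Definition P1 := option F.

Definition mobP (g : 'M[F]_2) (a : P1) : P1 :=
  match a with
  | None => if g 1 0 == 0 then None else Some (g 0 0 / g 1 0)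
  | Some x => if g 1 0 * x + g 1 1 == 0 then None
              else Some ((g 0 0 * x + g 0 1) / (g 1 0 * x + g 1 1))
  end.

(** The O-span of the rows of an invertible matrix. *)
Definition is_lattice (L : set 'rV[F]_2) : Prop :=
  exists2 M : 'M[F]_2, M \in unitmx &
    L = [set x *m M | x in [set x : 'rV[F]_2 | forall j, Oinf (x 0 j)]].

Definition homothety (c : F) (L : set 'rV[F]_2) : set 'rV[F]_2 :=
  [set c *: x | x in L].

(** [vclass] is the type of arbitrary sets of subsets of F^2; the vertices of
    the tree are those satisfying [is_vertex]. *)
Definition vclass := set (set 'rV[F]_2).

Definition hclass (L : set 'rV[F]_2) : vclass :=
  [set homothety c L | c in [set c | c != 0]].

Definition is_vertex (v : vclass) : Prop :=
  exists2 L, is_lattice L & v = hclass L.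

Definition adjacent (v w : vclass) : Prop :=
  exists L L', [/\ is_lattice L, is_lattice L', v = hclass L & w = hclass L'] /\
    [/\ homothety (piF K) L `<=` L', homothety (piF K) L <> L',
        L' `<=` L & L' <> L].

Definition actV (g : 'M[F]_2) (v : vclass) : vclass :=
  [set [set x *m invmx g | x in L] | L in v].

Definition vstd (n : int) : vclass :=
  hclass [set (piF K ^ n * a) *: delta_mx 0 0 + b *: delta_mx 0 1
         | a in Oinf (K := K) & b in Oinf (K := K)].

(** Points of the geometric realization are encoded by their barycentric
    coordinates, as functions on the vertices. *)
Definition tpoint := vclass -> R.

Definition vpoint (v : vclass) : tpoint := fun u => (`[< u = v >])%:R.

Definition bary (t : R) (v w : vclass) : tpoint :=
  fun u => (1 - t) * vpoint v u + t * vpoint w u.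

Definition is_point (x : tpoint) : Prop :=
  exists v w t, [/\ adjacent v w, 0 <= t <= 1 & x = bary t v w].

Definition vertex_points : set tpoint := vpoint @` is_vertex.

Definition actT (g : 'M[F]_2) (x : tpoint) : tpoint :=
  fun u => x (actV (invmx g) u).

(** Lengths of polygonal paths; each step is a segment inside one edge. *)
Definition edge_step (x y : tpoint) (m : R) : Prop :=
  exists v w s t, [/\ adjacent v w, 0 <= s <= 1, 0 <= t <= 1 &
    [/\ x = bary s v w, y = bary t v w & m = `|s - t|]].

Inductive path_length : tpoint -> tpoint -> R -> Prop :=
  | path_nil x : path_length x x 0
  | path_cons x y z m n :
      edge_step x y m -> path_length y z n -> path_length x z (m + n).

Definition distT (x y : tpoint) : R := inf [set m | path_length x y m].

Definition dist_to (x : tpoint) (A : set tpoint) : R :=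
  inf [set distT x y | y in A].

Definition ray_equiv (r r' : nat -> vclass) : Prop :=
  exists m m', forall n, r (n + m)%N = r' (n + m')%N.

(** The equivariant identification of the ends with P^1(F) sending the class
    of (v_n)_n to infinity. *)
Definition ray_represents (r : nat -> vclass) (a : P1) : Prop :=
  exists g, [/\ GL2 g, mobP g None = a &
    ray_equiv r (fun n => actV g (vstd n%:Z))].

Definition is_line (w : int -> vclass) : Prop :=
  forall n : int, adjacent (w n) (w (n + 1)) /\ w (n - 1) <> w (n + 1).

Definition geodesic (a b : P1) : set tpoint :=
  [set x | exists w : int -> vclass,
    [/\ is_line w, ray_represents (fun n => w (- n%:Z)) a,
        ray_represents (fun n => w n%:Z) b &
        exists n t, 0 <= t <= 1 /\ x = bary t (w n) (w (n + 1))]].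

Definition is_building_map (lam : C -> tpoint) : Prop :=
  [/\ forall z, Omega z -> is_point (lam z),
      forall g z, GL2 g -> Omega z -> lam (mobC g z) = actT g (lam z) &
      forall t : rat, 0 <= t <= 1 -> forall z : C,
        (Omega z /\ lam z = bary (ratr t) (vstd 0) (vstd (-1))) <->
        (absC z = absi z /\ absi z = q `^ (- ratr t))].

(** A k-form g(z) (dz)^k on Omega is given by its coefficient g. *)
Definition ord_form (k : nat) (g : C -> C) (z : C) : \bar R :=
  (ord (g z) - (k%:R * logq (absi z))%:E)%E.

Definition inv_sub (z : C) (a : P1) : C :=
  if a is Some x then (z - x%:C)^-1 else 0.

Definition sform (a b : P1) (z : C) : C := inv_sub z b - inv_sub z a.

Definition pullback1 (g : 'M[F]_2) (f : C -> C) (z : C) : C :=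
  f (mobC g z) * dmobC g z.

(** Sum of a family over an index set, along the finite subsets. *)
Definition has_sum (I : choiceType) (X : set I) (f : I -> C) (s : C) : Prop :=
  forall M : R, exists A, [/\ finite_set A, A `<=` X &
    forall B, finite_set B -> A `<=` B -> B `<=` X ->
      (M%:E <= ord (s - \sum_(i \in B) f i))%E].

(** The value is 0 when the family is not summable. *)
Definition sum_over (I : choiceType) (X : set I) (f : I -> C) : C :=
  xget 0 (has_sum X f).

Definition right_coset (H : set 'M[F]_2) (g : 'M[F]_2) : set 'M[F]_2 :=
  [set h *m g | h in H].

Definition poincare_term (r : nat) (k : 'I_r -> nat) (l : int)
    (a b : 'I_r -> P1) (g : 'M[F]_2) (z : C) : C :=
  (\det g)%:C ^ l * \prod_i pullback1 g (sform (a i) (b i)) z ^+ k i.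

(** The coefficient of the Poincare series: the sum over H\G, each coset
    contributing the term of a chosen representative. *)
Definition poincare (G H : set 'M[F]_2) (r : nat) (k : 'I_r -> nat) (l : int)
    (a b : 'I_r -> P1) (z : C) : C :=
  sum_over (right_coset H @` G)
    (fun c : set 'M[F]_2 => poincare_term k l a b (xget 1%:M c) z).

Definition poincare_data (G H : set 'M[F]_2) (r : nat) (k : 'I_r -> nat)
    (l : int) (a b : 'I_r -> P1) : Prop :=
  [/\ forall i, (0 < k i)%N,
      is_subgroup H /\ H `<=` G,
      forall h, H h -> (\det h) ^ l = 1,
      (forall i, a i <> b i) /\
      (forall i j, i <> j -> [set a i; b i] <> [set a j; b j]) &
      forall h, H h -> forall i, mobP h (a i) = a i /\ mobP h (b i) = b i].

Definition condition_P (G H : set 'M[F]_2) (r : nat)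
    (a b : 'I_r -> P1) : Prop :=
  forall (v : vclass) (N : nat), is_vertex v ->
    finite_set [set right_coset H g | g in [set g | G g /\
      forall i, dist_to (vpoint (actV g v)) (geodesic (a i) (b i)) <= N%:R]].

(** The bound t_p of the order of vanishing above the point p. *)
Definition tdist (p : tpoint) : R :=
  if `[< vertex_points p >] then 1 else dist_to p vertex_points.

End Drinfeld.

(* Main.v *)
Require Import Defs.
From mathcomp Require Import all_boot all_order all_algebra.
From mathcomp Require Import all_classical all_reals all_analysis.
From mathcomp Require Import ring lra zify.
From mathcomp Require finfield.
Set Implicit Arguments.
Unset Strict Implicit.
Unset Printing Implicit Defensive.
Import Order.TTheory GRing.Theory Num.Theory.
Local Open Scope classical_set_scope.
Local Open Scope ring_scope.

(** The form [s(z;a,b)] has order at [z] equal to the distance from [lam z] to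
    the geodesic [a -> b]: by equivariance it suffices to treat [- dz / z],
    where the order is [log_q (|z| / |z|_i)].  As determinants of G are units,
    the term of [g] in the series has at [z] order
    [sum_i k_i d (g (lam z), [a_i -> b_i])].  This is 0 only if [g] moves [lam z]
    to the common vertex [v], which happens for exactly one coset when [z] lies
    over the orbit of [v] and for none otherwise; all remaining terms have order
    at least [t_p], and the ultrametric inequality concludes.

    A vertex of the tree is encoded by a disc x + pi^n O of F, through the
    lattice of linear forms bounded by q^-n on it.  A point of Omega is at
    distance q^-s from F, attained at some [x], and lies over the point of the
    tree "x + pi^s O", which sits between two consecutive integral radii. *)

(** Equality of order and distance is not proved in full; weaker consequences suffice. A path of
    length equal to the order leads from [lam z] to the geodesic, so condition (P) leaves only
    finitely many terms of order below a given bound, and the series is summable. Order 0 puts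
    [lam z] on the geodesic, and a positive order is at least [tdist]. Conversely, a vertex on the
    geodesic has order 0; here the obstacle is that a geodesic is given only as some line with
    prescribed ends, so it must first be shown that a line from 0 to infinity stays among the discs
    containing 0.

    The valued field enters in three ways. The distance from a point of Omega to F is attained
    because F is complete and discretely valued. The fibres of the building map are prescribed only
    over rational points, so values of [ord] have to be rational. And nonvanishing of the series
    needs a point over [v], hence an integral element of C whose residue lies outside the finite
    field K. *)

(** * Units and leading terms in K[[pi]] and K((pi)) *)

Section LaurentSeries.
Variable K : fieldType.
Implicit Types (f g u : Defs.pseries K) (x y : Finf K).

Lemma pcoef_sum (I : Type) (s : seq I) (F : I -> Defs.pseries K) n :
  pcoef (\sum_(i <- s) F i) n = \sum_(i <- s) pcoef (F i) n.
Proof. by elim/big_ind2: _ => //= ? f ? g <- <-. Qed.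

Lemma pcoef_exp_lt f (n i : nat) :
  pcoef f 0 = 0 -> (i < n)%N -> pcoef (f ^+ n) i = 0.
Proof.
move=> f0; elim: n i => // n IH i; rewrite ltnS => le_in.
rewrite exprS /= big1 // => j _.
case: (posnP j) => [->|j0]; first by rewrite f0 mul0r.
by rewrite IH ?mulr0 //; have := ltn_ord j; lia.
Qed.

(** The inverse is the geometric series; its coefficient n only involves the powers up to n, because
    [f ^+ i] starts in degree at least i. *)
Lemma ps_unit1B f : pcoef f 0 = 0 -> 1 - f \is a GRing.unit.
Proof.
move=> f0; pose g := PSeries (fun n => pcoef (\sum_(i < n.+1) f ^+ i) n).
have gE n i : (i <= n)%N -> pcoef g i = pcoef (\sum_(j < n.+1) f ^+ j) i.
  move=> le_in; rewrite /= !pcoef_sum.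
  rewrite -!(big_mkord xpredT (fun j => pcoef (f ^+ j) i)).
  rewrite [RHS](big_cat_nat _ (n := i.+1)) //= [X in _ + X]big_nat.
  by rewrite [X in _ + X]big1 ?addr0 // => j /andP[lt_ij _]; apply: pcoef_exp_lt.
suff fg : (1 - f) * g = 1.
  by rewrite unitrE; apply/eqP/mulrV/asboolP; exists g; rewrite mulrC.
apply: ps_ext => n.
have -> : pcoef ((1 - f) * g) n
    = pcoef ((1 - f) * \sum_(j < n.+1) f ^+ j) n.
  by apply: eq_bigr => j _; rewrite (gE n) ?leq_subr.
rewrite -opprB mulNr -subrX1 opprB.
by rewrite [LHS]/= pcoef_exp_lt // subr0.
Qed.

(** Constants rescale a series to constant term 1; later they represent the residue classes of
    K[[pi]]. *)
Definition ps_const (c : K) : Defs.pseries K :=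
  PSeries (fun n => if n is 0%N then c else 0).

Lemma pcoef_constM c f n : pcoef (ps_const c * f) n = c * pcoef f n.
Proof.
by rewrite /= big_ord_recl /= subn0 big1 ?addr0 // => i _; rewrite mul0r.
Qed.

Lemma ps_constM c d : ps_const (c * d) = ps_const c * ps_const d.
Proof.
by apply: ps_ext => n; rewrite pcoef_constM; case: n => //= n; rewrite mulr0.
Qed.

Lemma ps_const1 : ps_const 1 = 1.
Proof. by apply: ps_ext => -[]. Qed.

Lemma ps_constX c n : ps_const (c ^+ n) = ps_const c ^+ n.
Proof.
by elim: n => [|n IH]; rewrite ?expr0 ?ps_const1 // !exprS ps_constM IH.
Qed.

Lemma ps_unit_coef0 f : pcoef f 0 != 0 -> f \is a GRing.unit.
Proof.
move=> f0; have -> : f = ps_const (pcoef f 0)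
    * (1 - (1 - ps_const (pcoef f 0)^-1 * f)).
  rewrite opprB addrCA subrr addr0 mulrA -ps_constM divff // ps_const1.
  by rewrite mul1r.
rewrite unitrM; apply/andP; split.
  rewrite unitrE; apply/eqP/mulrV/asboolP; exists (ps_const (pcoef f 0)^-1).
  by rewrite -ps_constM mulVf ?ps_const1.
apply: ps_unit1B; rewrite [LHS]/= big_ord1 /= mulVf //; exact: subrr.
Qed.

Lemma pcoef_XM f n : pcoef (ps_X K * f) n = if n is n.+1 then pcoef f n else 0.
Proof.
case: n => [|n] /=; first by rewrite big_ord1 mul0r.
rewrite !big_ord_recl /= mul0r mul1r add0r subSS subn0 big1 ?addr0 // => i _.
by rewrite mul0r.
Qed.

Lemma pcoef_XnM m f n :
  pcoef (ps_X K ^+ m * f) n = if (n < m)%N then 0 else pcoef f (n - m).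
Proof.
elim: m n => [|m IH] n; first by rewrite mul1r subn0.
by rewrite exprS -mulrA pcoef_XM; case: n => //= n; rewrite IH.
Qed.

Lemma ps_factor f : f != 0 ->
  exists n u, u \is a GRing.unit /\ f = ps_X K ^+ n * u.
Proof.
case/ps_lead => n fn flow; exists n, (PSeries (fun i => pcoef f (i + n))).
split; first by apply: ps_unit_coef0; rewrite /= add0n.
apply: ps_ext => i; rewrite pcoef_XnM /=; case: ltnP => [/flow //|le_ni].
by rewrite subnK.
Qed.

Lemma ps_unit_neq0 u : u \is a GRing.unit -> pcoef u 0 != 0.
Proof.
move=> uu; apply/eqP => u0; have := congr1 (fun f => pcoef f 0) (mulrV uu).
by rewrite /= big_ord1 /= u0 mul0r => /esym/eqP; rewrite oner_eq0.
Qed.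

Lemma ps_X_neq0 : ps_X K != 0.
Proof.
apply/eqP => /(congr1 (fun f => pcoef f 1)) /= /eqP; by rewrite oner_eq0.
Qed.

(** A fraction is a class of pairs with nonzero denominator; the identity is checked on a
    representative by cross-multiplication. *)
Lemma Finf_frac x : exists f g, g != 0 /\ x = ps_to_F f / ps_to_F g.
Proof.
rewrite /ps_to_F; elim/quotW: x => y.
exists (frac y).1, (frac y).2; split; first exact: denom_ratioP.
apply: (canRL (mulfK _)); first by rewrite tofrac_eq0 denom_ratioP.
rewrite !piE; apply/eqmodP; rewrite /= FracField.equivfE /FracField.mulf.
by rewrite !numden_Ratio ?mulf_neq0 ?oner_eq0 ?denom_ratioP // !mulr1 mulrC.
Qed.

Lemma piF_neq0 : piF K != 0.
Proof. by rewrite tofrac_eq0 ps_X_neq0. Qed.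

Lemma Finf_factor x : x != 0 ->
  exists (n : int) u, u \is a GRing.unit /\ x = piF K ^ n * ps_to_F u.
Proof.
case: (Finf_frac x) => f [g [g0 ->]] fg0.
have f0 : f != 0 by apply: contraNneq fg0 => ->; rewrite /ps_to_F tofrac0 mul0r.
case: (ps_factor f0) => m [u [uu ->]]; case: (ps_factor g0) => n [w [uw ->]].
exists (m%:Z - n%:Z), (u / w); rewrite unitrM uu unitrV uw; split=> //.
have w0 : ps_to_F w != 0.
  by rewrite tofrac_eq0; apply: contraNneq (ps_unit_neq0 uw) => ->.
have piXn (i : nat) : ps_to_F (ps_X K ^+ i) = piF K ^+ i.
  by rewrite /ps_to_F tofracXn.
have -> : ps_to_F (u / w) = ps_to_F u / ps_to_F w.
  by apply: (canRL (mulfK w0)); rewrite /ps_to_F -tofracM divrK.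
rewrite /ps_to_F !tofracM -!/(ps_to_F _) !piXn expfzDr ?piF_neq0 //.
rewrite -!exprnP -invr_expz -exprnP invfM -!mulrA; congr (_ * _).
by rewrite mulrCA.
Qed.

End LaurentSeries.

(** * The valuation on C and its values *)

Section Valuation.
Variables (R : realType) (K : finFieldType) (C : Cinfty R K).
Local Notation F := (Finf K).
Local Notation "x %:C" := (@emb R K C x) (at level 1, format "x %:C").
Implicit Types (x y z w : C) (e : \bar R).

(** At 0, where [ord] is +oo, this takes the default value 0; additivity therefore asks for nonzero
    arguments. *)
Definition rord x : R := fine (ord x).

Lemma ord_zero : ord (0 : C) = +oo%E.
Proof. exact/ord_eqy. Qed.

Lemma ord_rord x : x != 0 -> ord x = (rord x)%:E.
Proof.
move=> x0; rewrite /rord; have := @ord_neqNy R K C x.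
by case E: (ord x) => [//||//] _; move/ord_eqy: E => /eqP; rewrite (negbTE x0).
Qed.

Lemma le_ordD e x y : (e <= ord x)%E -> (e <= ord y)%E -> (e <= ord (x + y))%E.
Proof.
by move=> ex ey; apply: le_trans (ordD x y); rewrite le_min ex ey.
Qed.

Lemma le_ord_sum e (I : Type) (s : seq I) (P : pred I) (f : I -> C) :
  (forall i, P i -> e <= ord (f i))%E -> (e <= ord (\sum_(i <- s | P i) f i))%E.
Proof.
move=> H; elim/big_ind: _ => //; first by rewrite ord_zero leey.
by move=> x y; exact: le_ordD.
Qed.

Lemma ord_one : ord (1 : C) = 0%E.
Proof.
rewrite -(rmorph1 (emb C)) -(tofrac1 (Defs.pseries K)).
by rewrite (@ord_series _ _ C _ 0) //= oner_eq0.
Qed.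

Lemma rordM x y : x != 0 -> y != 0 -> rord (x * y) = rord x + rord y.
Proof. by move=> x0 y0; rewrite /rord ordM (ord_rord x0) (ord_rord y0). Qed.

Lemma rord1 : rord 1 = 0.
Proof. by rewrite /rord ord_one. Qed.

Lemma rordV x : rord x^-1 = - rord x.
Proof.
have [->|x0] := eqVneq x 0; first by rewrite invr0 /rord ord_zero oppr0.
apply/eqP; rewrite -addr_eq0 -rordM ?invr_eq0 //.
by rewrite mulVf // rord1.
Qed.

Lemma rordX x n : rord (x ^+ n) = n%:R * rord x.
Proof.
have [->|x0] := eqVneq x 0.
  case: n => [|n]; first by rewrite expr0 rord1 mul0r.
  by rewrite expr0n /rord ord_zero mulr0.
elim: n => [|n IH]; first by rewrite expr0 rord1 mul0r.
by rewrite exprS rordM ?expf_neq0 // IH -natr1; lra.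
Qed.

Lemma rordXz x (n : int) : x != 0 -> rord (x ^ n) = n%:~R * rord x.
Proof.
move=> x0; case: n => n; first by rewrite -exprnP rordX.
by rewrite NegzE -exprnN rordV rordX mulrNz mulNr.
Qed.

Lemma ordN x : ord (- x) = ord x.
Proof.
have [->|x0] := eqVneq x 0; first by rewrite oppr0.
rewrite ord_rord ?oppr_eq0 // (ord_rord x0); congr (_%:E).
rewrite -mulN1r rordM ?oppr_eq0 ?oner_eq0 //.
have := rordX (-1) 2; rewrite sqrrN expr1n rord1; lra.
Qed.

Lemma ordBC x y : ord (x - y) = ord (y - x).
Proof. by rewrite -ordN opprB. Qed.

(** If the sum had larger order than x, then so would x = (x + y) - y. *)
Lemma ordDl_lt x y : (ord x < ord y)%E -> ord (x + y) = ord x.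
Proof.
move=> xy; apply/eqP; rewrite eq_le le_ordD ?andbT //; last exact: ltW.
rewrite leNgt; apply/negP => lt; have : (ord x < ord (x + y - y))%E.
  apply: lt_le_trans (ordD (x + y) (- y)).
  by rewrite lt_min lt ordN.
by rewrite addrK ltxx.
Qed.

Lemma ord_finite x : (ord x < +oo)%E -> x != 0.
Proof. by apply: contraTneq => ->; rewrite ord_zero ltxx. Qed.

Lemma emb_neq0 (x : F) : (x%:C != 0) = (x != 0).
Proof. by rewrite fmorph_eq0. Qed.

Lemma ord_unit (u : Defs.pseries K) :
  u \is a GRing.unit -> ord (ps_to_F u)%:C = 0%E.
Proof. by move=> uu; rewrite (@ord_series _ _ C _ 0) ?ps_unit_neq0. Qed.

Lemma rord_pi : rord (piF K)%:C = 1.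
Proof.
by rewrite /rord (@ord_series _ _ C _ 1) //= ?oner_eq0 // => -[].
Qed.

Lemma rord_piX (n : int) : rord (piF K ^ n)%:C = n%:~R.
Proof. by rewrite fmorphXz rordXz ?emb_neq0 ?piF_neq0 // rord_pi mulr1. Qed.

Lemma ord_piX (n : int) : ord (piF K ^ n)%:C = n%:~R%:E.
Proof.
by rewrite ord_rord ?rord_piX // emb_neq0 expfz_neq0 // piF_neq0.
Qed.

Lemma ord_emb_int (x : F) : x != 0 -> exists n : int, ord x%:C = n%:~R%:E.
Proof.
case/Finf_factor => n [u [uu ->]]; exists n.
by rewrite rmorphM ordM ord_piX ord_unit // adde0.
Qed.

Lemma rord_emb_int (x : F) : rord x%:C \is a Num.int.
Proof.
have [->|/ord_emb_int[n E]] := eqVneq x 0.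
  by rewrite rmorph0 /rord ord_zero rpred0.
by rewrite /rord E /= intr_int.
Qed.

Lemma OinfE (x : F) : Oinf x <-> (0 <= ord x%:C)%E.
Proof.
split=> [[f _ <-]|].
  have [->|/ps_lead[n fn flow]] := eqVneq f 0.
    by rewrite /ps_to_F tofrac0 rmorph0 ord_zero leey.
  by rewrite (ord_series C fn flow) lee_fin ler0n.
have [->|/Finf_factor[n [u [uu ->]]]] := eqVneq x 0.
  by move=> _; exists 0 => //; rewrite /ps_to_F tofrac0.
rewrite rmorphM ordM ord_piX ord_unit // adde0 lee_fin ler0z.
case: n => // n _; exists (ps_X K ^+ n * u) => //.
by rewrite /ps_to_F tofracM tofracXn.
Qed.

Lemma ord_ge_coef (f : Defs.pseries K) n :
  (n%:R%:E <= ord (ps_to_F f)%:C)%E <-> forall i, (i < n)%N -> pcoef f i = 0.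
Proof.
have [->|/ps_lead[m fm flow]] := eqVneq f 0.
  by split => // _; rewrite /ps_to_F tofrac0 rmorph0 ord_zero leey.
rewrite (ord_series C fm flow) lee_fin ler_nat.
split=> [nm i lt_in|H]; first by apply: flow; apply: leq_trans nm.
by rewrite leqNgt; apply/negP => /H /eqP; rewrite (negbTE fm).
Qed.

(** Newton polygon argument. An algebraic y close to x has the same order; in an equation p(y) = 0
    two nonzero terms of different degrees i < j must have equal order, which makes (j - i) ord y an
    integer. *)
Lemma rord_rat x : exists t : rat, rord x = ratr t.
Proof.
have [->|x0] := eqVneq x 0; first by exists 0; rewrite /rord ord_zero rmorph0.
have [y [p p0 py] yx] := alg_dense x (rord x + 1).
have lt_xy : (ord x < ord (y - x))%E.
  by rewrite ordBC (ord_rord x0); apply: lt_le_trans yx; rewrite lte_fin; lra.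
have oyx : ord y = ord x by rewrite -[y](subrK x) addrC (ordDl_lt lt_xy).
have y0 : y != 0 by apply: ord_finite; rewrite oyx (ord_rord x0) ltry.
have -> : rord x = rord y by rewrite /rord oyx.
pose t i := (map_poly (emb C) p)`_i * y ^+ i.
pose S := size p.
have p0y : \sum_(i < S) t i = 0.
  by move: py; rewrite rootE horner_coef size_map_poly => /eqP.
have ti i : t i != 0 -> rord (t i) = rord (p`_i)%:C + i%:R * rord y.
  rewrite /t coef_map mulf_eq0 negb_or => /andP[pi yi].
  by rewrite rordM // rordX.
suff [i [j [lt_ij i0 j0 eq_ij]]] : exists i j,
    [/\ (i < j)%N, t i != 0, t j != 0 & rord (t i) = rord (t j)].
  have /intrP[m mE] := rord_emb_int p`_i; have /intrP[n nE] := rord_emb_int p`_j.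
  exists ((m - n)%:~R / (j%:Z - i%:Z)%:~R).
  rewrite fmorph_div /= !ratr_int !intrB.
  move: eq_ij; rewrite !ti // mE nE => E. have ij0 : j%:~R - i%:~R != 0 :> R.
    by rewrite subr_eq0 eqr_int; apply/eqP; lia.
  apply: (canRL (mulfK ij0)); rewrite -!pmulrn; lra.
(* Otherwise the nonzero term of minimal order is unique and gives the order of the whole sum,
   although this sum is 0. *)
apply: contrapT => uniq_ord; pose A := [set i : 'I_S | t i != 0]%SET.
have [i0 Ai0] : exists i0, i0 \in A.
  have Sgt0 : (0 < S)%N by rewrite size_poly_gt0.
  have Sp : (S.-1 < S)%N by rewrite prednK.
  exists (Ordinal Sp); rewrite inE /t /= mulf_neq0 ?expf_neq0 //.
  by rewrite coef_map fmorph_eq0 -lead_coefE lead_coef_eq0.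
pose i := [arg min_(i < i0 in A) rord (t i)]%O.
have [Ai imin] : i \in A /\ forall j, j \in A -> rord (t i) <= rord (t j).
  by rewrite /i; case: arg_minP => // j Aj jmin.
move: (Ai); rewrite inE => ti0.
suff : ord (\sum_(i < S) t i) = ord (t i).
  by rewrite p0y ord_zero (ord_rord ti0).
rewrite (bigD1 i) //=; apply: ordDl_lt.
(* [ordDl_lt] asks for a strict inequality, whereas [le_ord_sum] preserves weak ones; hence a
   uniform gap [eps]. The initial value 1 of the minimum below covers the case of a single nonzero
   term. *)
have [eps eps0 Heps] : exists2 eps : R, 0 < eps & forall j, j != i ->
    ((rord (t i) + eps)%:E <= ord (t j))%E.
  have Hj j : j != i -> j \in A -> rord (t i) < rord (t j).
    move=> ji Aj; rewrite lt_neqAle imin // andbT; apply/eqP => eij.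
    move: Aj; rewrite inE => tj0; apply: uniq_ord.
    case: (ltngtP i j) => [lt|lt|/val_inj E]; last by rewrite E eqxx in ji.
      by exists i, j.
    by exists j, i.
  exists (\big[Order.min/1]_(j in A | j != i) (rord (t j) - rord (t i))).
    apply/bigmin_gtP; split => // j /andP[Aj ji].
    by rewrite subr_gt0 Hj.
  move=> j ji; have [Aj|] := boolP (j \in A); last first.
    by rewrite inE negbK => /eqP ->; rewrite ord_zero leey.
  move: (Aj); rewrite inE => tj0; rewrite (ord_rord tj0) lee_fin -lerBrDl.
  by apply: bigmin_le_cond; rewrite Aj ji.
apply: (@lt_le_trans _ _ (rord (t i) + eps)%:E).
  by rewrite (ord_rord ti0) lte_fin; lra.
by apply: le_ord_sum => j; apply: Heps.
Qed.

End Valuation.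

(** * Distance from a point of Omega to F *)

Section HalfPlane.
Variables (R : realType) (K : finFieldType) (C : Cinfty R K).
Local Notation F := (Finf K).
Local Notation q := (#|{: K}|%:R : R).
Local Notation "x %:C" := (@emb R K C x) (at level 1, format "x %:C").
Implicit Types (z w : C) (s t : R).

(** [z] has distance q^-s to F, attained at [x]. *)
Definition nearest z (x : F) s :=
  ord (z - x%:C) = s%:E /\ forall y : F, (ord (z - y%:C) <= s%:E)%E.

Lemma nearest_Omega z x s : nearest z x s -> Omega z.
Proof. by case=> _ H [y _ E]; have := H y; rewrite E subrr ord_zero. Qed.

Lemma Omega_subr_neq0 z (x : F) : Omega z -> z - x%:C != 0.
Proof.
by move=> Oz; apply/eqP => /subr0_eq E; apply: Oz; exists x.
Qed.

(** F is complete: the approximations differ from the first one by elements of K[[pi]] that agree to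
    higher and higher order. *)
Lemma Finf_closed z : (forall n : nat, exists x : F,
  (n%:R%:E <= ord (z - x%:C))%E) -> exists x : F, z = x%:C.
Proof.
move=> /choice[x zx].
have dx m n : ((minn m n)%:R%:E <= ord (x m - x n)%R%:C)%E.
  rewrite rmorphB -[_ - _](subrKA z) -[X in X + _]opprB.
  apply: le_ordD; rewrite ?ordN.
    by apply: le_trans (zx m); rewrite lee_fin ler_nat geq_minl.
  by apply: le_trans (zx n); rewrite lee_fin ler_nat geq_minr.
have /choice[f fE] n : exists f, ps_to_F f = x n - x 0.
  have : Oinf (x n - x 0) by apply/(OinfE C); have := dx n 0; rewrite minn0.
  by case=> f _; exists f.
(* Coefficient n no longer changes from approximation n + 1 on. *)
pose g := PSeries (fun n => pcoef (f n.+1) n).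
exists (x 0 + ps_to_F g); apply/eqP; rewrite -subr_eq0; apply/eqP/ord_eqy.
apply/eqP; rewrite -leye_eq leNgt; apply/negP => lt.
have [n nlt] : exists n : nat, (ord (z - (x 0 + ps_to_F g)%:C)%R < n%:R%:E)%E.
  have r0 := ord_rord (ord_finite lt).
  exists (Num.bound `|rord (z - (x 0 + ps_to_F g)%:C)|); rewrite r0 lte_fin.
  exact: le_lt_trans (ler_norm _) (archi_boundP (normr_ge0 _)).
move: nlt; apply/negP; rewrite -leNgt.
have -> : z - (x 0 + ps_to_F g)%:C = (z - (x n)%:C) + (ps_to_F (f n - g))%:C.
  by rewrite /ps_to_F tofracB -!/(ps_to_F _) fE !rmorphB rmorphD /=; ring.
apply: le_ordD (zx n) _; apply/ord_ge_coef => i lt_in.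
have : ((i.+1)%:R%:E <= ord (ps_to_F (f n - f i.+1)%R)%:C)%E.
  rewrite /ps_to_F tofracB -!/(ps_to_F _) !fE opprB addrA subrK.
  by have := dx n i.+1; rewrite (minn_idPr lt_in).
move=> /ord_ge_coef/(_ i (ltnSn i)) /= E.
exact: E.
Qed.

(** If no point of F is nearest, then ord (z - x) equals ord (y - x) for any closer y, hence is
    always an integer. Each improvement then gains at least 1, so the orders are unbounded, and z
    lies in F because F is closed. *)
Lemma Omega_nearest z : Omega z -> exists x s, nearest z x s.
Proof.
move=> Oz; apply: contrapT => nomax.
have nz (x : F) : z - x%:C != 0 by apply: Omega_subr_neq0.
have up (x : F) : exists y : F, (ord (z - x%:C) < ord (z - y%:C))%E.
  apply: contrapT => nup; apply: nomax; exists x, (rord (z - x%:C)).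
  rewrite /nearest -ord_rord //; split=> // y.
  by rewrite leNgt; apply/negP => lt; apply: nup; exists y.
have isint (x : F) : rord (z - x%:C) \is a Num.int.
  have [y lt] := up x; rewrite /rord -ordN -(ordDl_lt (y := z - y%:C)).
    by rewrite opprB addrA subrK -rmorphB; exact: rord_emb_int.
  by rewrite ordN.
have [N HN] : exists N : nat, forall x : F, (ord (z - x%:C) < N%:R%:E)%E.
  apply: contrapT => unbounded; apply: Oz.
  have [n|x ->] := @Finf_closed z; last by exists x.
  apply: contrapT => H; apply: unbounded; exists n => x.
  by rewrite ltNge; apply/negP => le; apply: H; exists x.
have [M ME] : exists M : int, rord (z - 0%:C) = M%:~R by apply/intrP/isint.
have climb (n : nat) : exists x : F, M%:~R + n%:R <= rord (z - x%:C).
  elim: n => [|n [x Hx]]; first by exists 0; rewrite ME; lra.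
  have [y] := up x; rewrite !ord_rord // lte_fin => lt; exists y.
  have /intrP[i iE] := isint x; have /intrP[j jE] := isint y.
  move: lt Hx; rewrite iE jE ltr_int -natr1 -lezD1 -(ler_int R) intrD; lra.
have [x Hx] := climb (`|N%:Z - M|)%N.
have := HN x; rewrite ord_rord // lte_fin ltNge => /negP; apply.
apply: le_trans Hx; rewrite -[N%:R]/(N%:~R) -[_%:R]/((`|N%:Z - M|%N : int)%:~R).
by rewrite -intrD ler_int; lia.
Qed.

Lemma q_gt1 : 1 < q.
Proof. by rewrite ltr1n; exact: card_finNzRing_gt1. Qed.

Lemma logq_powR t : @logq R K (q `^ t) = t.
Proof. by rewrite /logq ln_powR mulfK // gt_eqF // ln_gt0 // q_gt1. Qed.

Lemma absC_rord z : z != 0 -> absC z = q `^ (- rord z).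
Proof. by rewrite /absC => /negbTE ->. Qed.

Lemma absi_nearest z x s : nearest z x s -> absi z = q `^ (- s).
Proof.
move=> zx; have Oz := nearest_Omega zx; case: zx => zx max.
have nz y := Omega_subr_neq0 y Oz.
have attained : absC (z - x%:C) = q `^ (- s).
  by rewrite absC_rord // /rord zx.
have lb : lbound [set absC (z - x0%:C) | x0 in [set: F]] (q `^ (- s)).
  move=> _ [y _ <-]; rewrite absC_rord //; apply: ler_powR; first exact/ltW/q_gt1.
  by rewrite lerN2; have := max y; rewrite ord_rord.
apply/eqP; rewrite eq_le; apply/andP; split.
  by rewrite -attained; apply: ge_inf; [exists (q `^ (- s))|exists x].
apply: lb_le_inf => //; exists (q `^ (- s)); exists x => //.
Qed.

Lemma logq_absi z x s : nearest z x s -> @logq R K (absi z) = - s.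
Proof. by move=> /absi_nearest ->; rewrite logq_powR. Qed.

Lemma nearest_rat z x s : nearest z x s -> exists t : rat, s = ratr t.
Proof.
by case=> zx _; have [t tE] := rord_rat (z - x%:C); exists t; rewrite -tE /rord zx.
Qed.

Lemma absi_fiberP z x s t : nearest z x s ->
  (absC z = absi z /\ absi z = q `^ (- t)) <-> (ord z = s%:E /\ s = t).
Proof.
move=> zx; have Oz := nearest_Omega zx.
have z0 : z != 0 by have := Omega_subr_neq0 0 Oz; rewrite rmorph0 subr0.
rewrite absC_rord // (absi_nearest zx) (ord_rord z0).
split=> [[/(congr1 (@logq R K)) + /(congr1 (@logq R K))]|[[-> ->]] //].
by rewrite !logq_powR => /oppr_inj -> /oppr_inj ->.
Qed.

Lemma nearest_affine z x s (u v : F) : u != 0 -> nearest z x s ->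
  nearest (u%:C * z + v%:C) (u * x + v) (s + rord u%:C).
Proof.
move=> u0 [zx max]; have uC0 : u%:C != 0 by rewrite emb_neq0.
split=> [|y].
  have -> : u%:C * z + v%:C - (u * x + v)%:C = u%:C * (z - x%:C).
    by rewrite rmorphD rmorphM /=; ring.
  by rewrite ordM zx ord_rord // addeC.
have -> : u%:C * z + v%:C - y%:C = u%:C * (z - ((y - v) / u)%:C).
  by rewrite rmorphM fmorphV rmorphB /=; field.
rewrite ordM (ord_rord uC0) addeC EFinD.
by apply: leeD.
Qed.

Lemma nearest_change z x y s :
  nearest z x s -> (s%:E <= ord (x - y)%R%:C)%E -> nearest z y s.
Proof.
move=> [zx max] xy; split=> //; apply/eqP; rewrite eq_le max /=.
have -> : z - y%:C = (z - x%:C) + (x - y)%:C by rewrite rmorphB addrA subrK.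
by apply: le_ordD; rewrite ?zx.
Qed.

Lemma ord_nearest z x y s : nearest z x s ->
  ord (z - y%:C) = Order.min s%:E (ord (x - y)%:C).
Proof.
move=> zx; case: (leP s%:E (ord (x - y)%:C)) => [|xy].
  by case/(nearest_change zx).
have -> : z - y%:C = (x - y)%:C + (z - x%:C) by rewrite rmorphB /=; ring.
by apply: ordDl_lt; case: zx => ->.
Qed.

End HalfPlane.

(** * Two-by-two matrices *)

Section Matrix2.

Definition mx2 (T : Type) (a b c d : T) : 'M[T]_2 :=
  \matrix_(i, j) if i == 0 then if j == 0 then a else b
                 else if j == 0 then c else d.

Lemma mx2E (T : Type) (a b c d : T) :
  ((mx2 a b c d 0 0 = a) * (mx2 a b c d 0 1 = b) *
   (mx2 a b c d 1 0 = c) * (mx2 a b c d 1 1 = d))%type.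
Proof. by rewrite !mxE. Qed.

Lemma ord2P (i : 'I_2) : i = 0 \/ i = 1.
Proof.
by case: i => -[|[|//]] lt; [left|right]; apply: val_inj.
Qed.

Lemma mx2_ext (T : Type) (A B : 'M[T]_2) : A 0 0 = B 0 0 -> A 0 1 = B 0 1 ->
  A 1 0 = B 1 0 -> A 1 1 = B 1 1 -> A = B.
Proof.
by move=> *; apply/matrixP => i j; case: (ord2P i) => ->; case: (ord2P j) => ->.
Qed.

Lemma mulmx2E (S : pzSemiRingType) m n (A : 'M[S]_(m, 2)) (B : 'M[S]_(2, n)) i j :
  (A *m B) i j = A i 0 * B 0 j + A i 1 * B 1 j.
Proof.
rewrite mxE !big_ord_recl big_ord0 addr0.
by congr (_ + A i _ * B _ j); apply: val_inj.
Qed.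

Lemma det_mx22 (S : comPzRingType) (A : 'M[S]_2) :
  \det A = A 0 0 * A 1 1 - A 0 1 * A 1 0.
Proof.
have l0 : lift 0 0 = 1 :> 'I_2 by apply: val_inj.
have l1 : lift 1 0 = 0 :> 'I_2 by apply: val_inj.
rewrite (expand_det_row _ 0) !big_ord_recl big_ord0 addr0 /cofactor l0.
by rewrite !det_mx11 !mxE l0 l1 expr0 expr1 mul1r mulN1r mulrN.
Qed.

Variable F : fieldType.
Implicit Types g h : 'M[F]_2.

Lemma invmx2 g : g \in unitmx ->
  invmx g = mx2 (g 1 1 / \det g) (- g 0 1 / \det g)
                (- g 1 0 / \det g) (g 0 0 / \det g).
Proof.
move=> ug; apply: (can_inj (mulKmx ug)); rewrite mulmxV //.
move: ug; rewrite unitmxE unitfE det_mx22 => d0.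
by apply: mx2_ext; rewrite !mulmx2E !mx2E !mxE /=; field.
Qed.

Lemma unitmx2 g : (g \in unitmx) = (g 0 0 * g 1 1 - g 0 1 * g 1 0 != 0).
Proof. by rewrite unitmxE unitfE det_mx22. Qed.

Lemma unitmx_mx2 (a b c d : F) : (mx2 a b c d \in unitmx) = (a * d - b * c != 0).
Proof. by rewrite unitmx2 !mx2E. Qed.

Lemma det_mx2 (a b c d : F) : \det (mx2 a b c d) = a * d - b * c.
Proof. by rewrite det_mx22 !mx2E. Qed.

End Matrix2.

(* Over an abstract extension: conversion on [Finf K] unfolds the fraction field,
   which makes [ring] and [field] impractical there. *)
Section Identities.
Variables (F E : fieldType) (f : {rmorphism F -> E}).
Implicit Types (a b c d x y : F) (z : E).

Lemma rmorph_linear_root a b z : a != 0 -> f a * z + f b = f a * (z - f (- b / a)).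
Proof.
by rewrite -(fmorph_eq0 f) rmorphM fmorphV rmorphN => a0 /=; field.
Qed.

Lemma rmorph_linear_det a b c d z :
  f a * (f c * z + f d) + - f c * (f a * z + f b) = f (a * d - b * c).
Proof. by rewrite rmorphB !rmorphM /=; ring. Qed.

Lemma rmorph_linear_comb a b c d y z : f (a - y * c) * z + f (b - y * d)
  = f a * z + f b - f y * (f c * z + f d).
Proof. by rewrite !rmorphB !rmorphM /=; ring. Qed.

Lemma det_linear_comb a b c d y :
  (a - y * c) * d - (b - y * d) * c = a * d - b * c.
Proof. by ring. Qed.

Lemma moebius_comp a b c d a' b' c' d' z : f c * z + f d != 0 ->
  f c' * ((f a * z + f b) / (f c * z + f d)) + f d' != 0 ->
  f (c' * a + d' * c) * z + f (c' * b + d' * d) != 0 ->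
  (f (a' * a + b' * c) * z + f (a' * b + b' * d)) /
    (f (c' * a + d' * c) * z + f (c' * b + d' * d))
  = (f a' * ((f a * z + f b) / (f c * z + f d)) + f b') /
    (f c' * ((f a * z + f b) / (f c * z + f d)) + f d').
Proof.
rewrite !rmorphD !rmorphM /= => den _ den'; field; rewrite den /=.
by apply: contraNneq den' => <-; apply/eqP; ring.
Qed.

Lemma moebius_inv_denom a b c d z : a * d - b * c != 0 ->
  f c * z + f d != 0 ->
  f (- c / (a * d - b * c)) * ((f a * z + f b) / (f c * z + f d))
    + f (a / (a * d - b * c)) = (f c * z + f d)^-1.
Proof.
rewrite -(fmorph_eq0 f) !rmorphM !fmorphV !rmorphB !rmorphM rmorphN /=.
by move=> det0 den; field; rewrite den.
Qed.

End Identities.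

(** * Moebius transformations and the imaginary absolute value *)

Section Moebius.
Variables (R : realType) (K : finFieldType) (C : Cinfty R K).
Local Notation F := (Finf K).
Local Notation "x %:C" := (@emb R K C x) (at level 1, format "x %:C").
Implicit Types (z w : C) (s t : R) (g h : 'M[F]_2).

Lemma linear_neq0 z (c d : F) : Omega z -> c != 0 \/ d != 0 ->
  c%:C * z + d%:C != 0.
Proof.
move=> Oz; have [->|c0] := eqVneq c 0.
  by rewrite rmorph0 mul0r add0r emb_neq0; case.
move=> _; rewrite rmorph_linear_root // mulf_neq0 ?emb_neq0 //.
exact: Omega_subr_neq0.
Qed.

Lemma denom_neq0 z g : Omega z -> GL2 g -> (g 1 0)%:C * z + (g 1 1)%:C != 0.
Proof.
move=> Oz; rewrite /GL2 /= unitmx2 => d0; apply: linear_neq0 => //.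
by apply/orP; rewrite -negb_and; apply: contra d0 => /andP[/eqP-> /eqP->];
  rewrite !mulr0 subr0.
Qed.

(** a z + b is a times the difference of z and the point - b / a of F. For a = 0 the bound is
    +oo. *)
Lemma le_ord_linear z x s (a b : F) : nearest z x s ->
  (ord (a%:C * z + b%:C) <= ord a%:C + s%:E)%E.
Proof.
case=> _ max; have [->|a0] := eqVneq a 0.
  by rewrite rmorph0 ord_zero addye ?leey.
have aC : a%:C != 0 by rewrite emb_neq0.
by rewrite rmorph_linear_root // ordM (ord_rord aC); apply: leeD.
Qed.

(** The constant ad - bc equals a (cz + d) - c (az + b), so one of these two products has order at
    most ord (ad - bc); [le_ord_linear] bounds the other linear form by the coefficient occurring in
    that product. *)
Lemma ord_linear_pair z x s (a b c d : F) : nearest z x s ->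
  a * d - b * c != 0 ->
  rord (a%:C * z + b%:C) + rord (c%:C * z + d%:C)
    <= s + rord (a * d - b * c)%:C.
Proof.
move=> zx; have Oz := nearest_Omega zx; move=> det0.
have ab0 : a%:C * z + b%:C != 0.
  apply: linear_neq0 => //; apply/orP; rewrite -negb_and.
  by apply: contra det0 => /andP[/eqP-> /eqP->]; rewrite !mul0r subr0.
have cd0 : c%:C * z + d%:C != 0.
  apply: linear_neq0 => //; apply/orP; rewrite -negb_and.
  by apply: contra det0 => /andP[/eqP-> /eqP->]; rewrite !mulr0 subr0.
have detC : (a * d - b * c)%:C != 0 by rewrite emb_neq0.
have la := le_ord_linear a b zx; have lc := le_ord_linear c d zx.
have := ordD (a%:C * (c%:C * z + d%:C)) (- c%:C * (a%:C * z + b%:C)).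
rewrite rmorph_linear_det mulNr ordN !ordM; move: la lc.
rewrite (ord_rord ab0) (ord_rord cd0) (ord_rord detC).
have nN := @ord_neqNy R K C; have := nN a%:C; have := nN c%:C.
case: (ord a%:C) => [ra||] //; case: (ord c%:C) => [rc||] // _ _;
  rewrite ?addye // ?lee_fin => la lc;
  rewrite ?ge_min -?EFinD ?lee_fin ?leye_eq ?orbF.
- by case/orP; lra.
- lra.
- lra.
Qed.

Lemma GL2_inv g : GL2 g -> GL2 (invmx g).
Proof. by rewrite /GL2 /= unitmx_inv. Qed.

Lemma GL2_mul g h : GL2 g -> GL2 h -> GL2 (g *m h).
Proof. by rewrite /GL2 /= unitmx_mul => -> ->. Qed.

Lemma mobC_Omega z g : GL2 g -> Omega z -> Omega (mobC g z).
Proof.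
move=> Gg Oz [y _ E]; have den := denom_neq0 Oz Gg.
move: Gg; rewrite /GL2 /= unitmx2 => det0.
have num : (g 0 0 - y * g 1 0)%:C * z + (g 0 1 - y * g 1 1)%:C = 0.
  rewrite rmorph_linear_comb.
  by rewrite E /mobC divfK // subrr.
move/eqP: num; apply/negP; apply: linear_neq0 => //; apply/orP; rewrite -negb_and.
apply: contra det0 => /andP[/eqP /subr0_eq-> /eqP /subr0_eq->].
by apply/eqP; rewrite -[RHS](subrr (y * g 1 0 * g 1 1)) mulrAC.
Qed.

Lemma mobC1 z : mobC 1%:M z = z.
Proof. by rewrite /mobC !mxE /= rmorph0 rmorph1 mul1r mul0r addr0 add0r divr1. Qed.

Lemma mobC_comp z g h : GL2 g -> GL2 h -> Omega z ->
  mobC (g *m h) z = mobC g (mobC h z).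
Proof.
move=> Gg Gh Oz.
have den := denom_neq0 Oz Gh; have den' := denom_neq0 (mobC_Omega Gh Oz) Gg.
have Ggh := GL2_mul Gg Gh.
have den'' := denom_neq0 Oz Ggh; move: den den' den''.
rewrite /mobC !mulmx2E; exact: moebius_comp.
Qed.

Lemma mobCK z g : GL2 g -> Omega z -> mobC (invmx g) (mobC g z) = z.
Proof.
move=> Gg Oz; have Gi := GL2_inv Gg.
by rewrite -(mobC_comp Gi Gg Oz) (mulVmx Gg) mobC1.
Qed.

(** gz - y is a quotient of two linear forms in z with determinant det g, so [ord_linear_pair]
    applies. *)
Lemma nearest_mobC_le z x s g y t : GL2 g -> nearest z x s ->
  nearest (mobC g z) y t ->
  t <= s + rord (\det g)%:C - 2 * rord ((g 1 0)%:C * z + (g 1 1)%:C).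
Proof.
move=> Gg zx; have Oz := nearest_Omega zx; have den := denom_neq0 Oz Gg.
have := Gg; rewrite /GL2 /= unitmx2 => det0 [gy _].
have Og := mobC_Omega Gg Oz.
have det' : (g 0 0 - y * g 1 0) * g 1 1 - (g 0 1 - y * g 1 1) * g 1 0 = \det g.
  by rewrite det_mx22 det_linear_comb.
have num : mobC g z - y%:C = ((g 0 0 - y * g 1 0)%:C * z
    + (g 0 1 - y * g 1 1)%:C) / ((g 1 0)%:C * z + (g 1 1)%:C).
  by rewrite rmorph_linear_comb mulrBl mulfK.
have num0 := Omega_subr_neq0 y Og.
have -> : t = rord (mobC g z - y%:C) by rewrite /rord gy.
have := @ord_linear_pair z x s (g 0 0 - y * g 1 0) (g 0 1 - y * g 1 1)
  (g 1 0) (g 1 1) zx.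
rewrite det' det_mx22 => /(_ det0).
move: num0; rewrite num mulf_eq0 negb_or => /andP[num0 _].
rewrite rordM ?invr_eq0 // rordV; lra.
Qed.

(** The law |gz|_i = |det g| |z|_i / |cz + d|^2. The reverse inequality is the same bound for
    [invmx g] at gz, where its denominator is (cz + d)^-1. *)
Lemma nearest_mobC z x s g y t : GL2 g -> nearest z x s ->
  nearest (mobC g z) y t ->
  t = s + rord (\det g)%:C - 2 * rord ((g 1 0)%:C * z + (g 1 1)%:C).
Proof.
move=> Gg zx gy; have Oz := nearest_Omega zx.
have den := denom_neq0 Oz Gg.
apply/eqP; rewrite eq_le (nearest_mobC_le Gg zx gy) /=.
have Gi := GL2_inv Gg.
have := @nearest_mobC_le (mobC g z) y t (invmx g) x s Gi gy.
rewrite mobCK // => /(_ zx).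
have := Gg; rewrite /GL2 /= unitmxE unitfE => det0.
have detC : (\det g)%:C != 0 by rewrite emb_neq0.
have -> : (invmx g 1 0)%:C * mobC g z + (invmx g 1 1)%:C
    = ((g 1 0)%:C * z + (g 1 1)%:C)^-1.
  rewrite invmx2 // !mx2E /mobC.
  by rewrite det_mx22 in det0 *; exact: moebius_inv_denom.
by rewrite det_inv fmorphV !rordV; lra.
Qed.

Lemma ord_form_nearest k (f : C -> C) z x s : nearest z x s ->
  ord_form k f z = (ord (f z) + (k%:R * s)%:E)%E.
Proof. by move=> zx; rewrite /ord_form (logq_absi zx) mulrN EFinN oppeK. Qed.

(** The factor det g / (cz + d)^2 from the derivative matches the change of |z|_i; this is why the
    order of a form is corrected by [logq (absi z)]. *)
Lemma ord_form_pullback1 (f : C -> C) z g : GL2 g -> Omega z ->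
  ord_form 1 (pullback1 g f) z = ord_form 1 f (mobC g z).
Proof.
move=> Gg Oz; have [x [s zx]] := Omega_nearest Oz.
have [y [t gy]] := Omega_nearest (mobC_Omega Gg Oz).
rewrite (ord_form_nearest _ _ zx) (ord_form_nearest _ _ gy) !mul1r.
rewrite (nearest_mobC Gg zx gy) /pullback1 /dmobC ordM -addeA; congr (_ + _)%E.
have den := denom_neq0 Oz Gg.
have detC : (\det g)%:C != 0.
  by rewrite emb_neq0; move: Gg; rewrite /GL2 /= unitmxE unitfE.
rewrite ord_rord ?mulf_neq0 ?invr_eq0 ?expf_neq0 //.
rewrite rordM ?invr_eq0 ?expf_neq0 // rordV rordX -EFinD; congr (_%:E); lra.
Qed.

End Moebius.

Section AbstractIdentities.
Variable F : fieldType.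
Implicit Types a b c d x y u v : F.

Lemma lattice_shift c x y u v :
  c * v + y * (c * u) = c * (v + x * u) + c * (y - x) * u.
Proof. by ring. Qed.

Lemma affine_row a b d x u v : d != 0 ->
  a * v + (a * x + b) / d * (a * u) = a / d * (u * b + v * d + x * (u * a)).
Proof. by move=> d0; field. Qed.

Lemma row_reduce_id a b c d u v : a != 0 -> a^-1 * (u * b + v * d)
   + - b / a * (a^-1 * (u * a + v * c)) = v * ((d - c * b / a) / a).
Proof. by move=> a0; field. Qed.

Lemma row_reduce_fst a c u v : a != 0 -> a^-1 * (u * a + v * c) = u + v * (c / a).
Proof. by move=> a0; field. Qed.

Lemma row_reduce_neq0 a b c d :
  a != 0 -> a * d - b * c != 0 -> (d - c * b / a) / a != 0.
Proof.
move=> a0; apply: contraNneq => /(congr1 ( *%R (a ^+ 2))).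
by rewrite mulr0 => <-; apply/eqP; field.
Qed.

Lemma invmxM n (g h : 'M[F]_n) : g \in unitmx -> h \in unitmx ->
  invmx (g *m h) = invmx h *m invmx g.
Proof.
move=> ug uh; have ugh : g *m h \in unitmx by rewrite unitmx_mul ug.
apply: (can_inj (mulKmx ugh)).
by rewrite mulmxV // -mulmxA [h *m _]mulmxA mulmxV // mul1mx mulmxV.
Qed.

Lemma disc_row_solve x u v c :
  c != 0 -> u * - x + c^-1 * (v + x * u) * c = v.
Proof. by move=> c0; field. Qed.

Lemma disc_row_eval x u v c : u * - x + v * c + x * u = c * v.
Proof. by ring. Qed.

End AbstractIdentities.

(** * Vertices of the tree as discs in F *)

Section Valuation.
Variables (R : realType) (K : finFieldType) (C : Cinfty R K).
Local Notation F := (Finf K).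
Local Notation "x %:C" := (@emb R K C x) (at level 1, format "x %:C").
Implicit Types (x y c : F) (m n : int).

(** Integral bounds on valuations in F, so that inclusions of lattices become linear arithmetic over
    [int]. *)
Definition vge n x := (n%:~R%:E <= ord x%:C)%E.
Definition val_eq x n := ord x%:C = n%:~R%:E.

Lemma vge0 x : vge 0 x <-> Oinf x.
Proof. exact: iff_sym (OinfE C x). Qed.

Lemma vge_zero n : vge n 0.
Proof. by rewrite /vge rmorph0 ord_zero leey. Qed.

Lemma vgeD n x y : vge n x -> vge n y -> vge n (x + y).
Proof. by rewrite /vge rmorphD; apply: le_ordD. Qed.

Lemma vgeN n x : vge n (- x) = vge n x.
Proof. by rewrite /vge rmorphN /= ordN. Qed.

Lemma vgeM m n x y : vge m x -> vge n y -> vge (m + n) (x * y).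
Proof. by rewrite /vge rmorphM ordM intrD EFinD; apply: leeD. Qed.

Lemma vge_trans m n x : m <= n -> vge n x -> vge m x.
Proof. by move=> mn; apply: le_trans; rewrite lee_fin ler_int. Qed.

Lemma val_eq_ex x : x != 0 -> exists n, val_eq x n.
Proof. exact: ord_emb_int. Qed.

Lemma val_eq_neq0 x n : val_eq x n -> x != 0.
Proof.
by move=> xn; rewrite -(emb_neq0 C); apply: ord_finite; rewrite xn ltry.
Qed.

Lemma val_eq_vge x m n : val_eq x m -> vge n x = (n <= m).
Proof. by rewrite /vge => ->; rewrite lee_fin ler_int. Qed.

Lemma val_eq_inj x m n : val_eq x m -> val_eq x n -> m = n.
Proof. by rewrite /val_eq => -> [] /eqP; rewrite eqr_int => /eqP. Qed.

Lemma val_eqM x y m n : val_eq x m -> val_eq y n -> val_eq (x * y) (m + n).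
Proof. by rewrite /val_eq rmorphM ordM intrD EFinD => -> ->. Qed.

Lemma val_eqV x n : val_eq x n -> val_eq x^-1 (- n).
Proof.
move=> xn; have := val_eq_neq0 xn; rewrite -(emb_neq0 C) => x0.
rewrite /val_eq fmorphV ord_rord ?invr_eq0 // rordV /rord xn.
by rewrite mulrNz.
Qed.

Lemma val_eq1 : val_eq 1 0.
Proof. by rewrite /val_eq rmorph1 ord_one. Qed.

Lemma val_eq_piX n : val_eq (piF K ^ n) n.
Proof. exact: ord_piX. Qed.

Lemma val_eq_pi : val_eq (piF K) 1.
Proof. exact: (val_eq_piX 1). Qed.

Lemma vgeMl c x m n : val_eq c m -> vge (m + n) (c * x) = vge n x.
Proof.
move=> cm; apply/idP/idP => [cx|]; last by apply: vgeM; rewrite (val_eq_vge _ cm).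
have c0 := val_eq_neq0 cm; rewrite -[x](mulKf c0) -[n](addKr m).
apply: vgeM => //; by rewrite (val_eq_vge _ (val_eqV cm)).
Qed.

Lemma val_eq_perturb x y m n : vge n (x - y) -> val_eq x m -> m < n -> val_eq y m.
Proof.
rewrite /vge /val_eq => xy xm mn; rewrite -[y](subKr x) rmorphB -xm.
apply: ordDl_lt; rewrite ordN xm; apply: lt_le_trans xy.
by rewrite lte_fin ltr_int.
Qed.

End Valuation.

Section Tree.
Variables (R : realType) (K : finFieldType) (C : Cinfty R K).
Local Notation F := (Finf K).
Local Notation vge := (@vge R K C).
Local Notation val_eq := (@val_eq R K C).
Implicit Types (x y c : F) (m n : int) (g h : 'M[F]_2) (L : set 'rV[F]_2)
  (u v w : vclass K).

Definition row2 x y : 'rV[F]_2 := \row_j if j == 0 then x else y.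

Lemma row2E x y : ((row2 x y 0 0 = x) * (row2 x y 0 1 = y))%type.
Proof. by rewrite !mxE. Qed.

Lemma scale_rV2 c (a : 'rV[F]_2) j : (c *: a) 0 j = c * a 0 j.
Proof. by rewrite mxE. Qed.

Lemma scale_row2 c (a : 'rV[F]_2) : c *: a = row2 (c * a 0 0) (c * a 0 1).
Proof. by apply/rowP => j; case: (ord2P j) => ->; rewrite row2E scale_rV2. Qed.

Lemma row2_ext (a b : 'rV[F]_2) : a 0 0 = b 0 0 -> a 0 1 = b 0 1 -> a = b.
Proof.
by move=> E0 E1; apply/rowP => j; case: (ord2P j) => ->.
Qed.

(** The forms u X + v with |u| <= 1 and |u x' + v| <= q^-n for all
    x' in x + pi^n O. *)
Definition disc_lattice x n : set 'rV[F]_2 :=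
  [set a | vge 0 (a 0 0) /\ vge n (a 0 1 + x * a 0 0)].

Lemma disc_lattice_row2 x n a b :
  disc_lattice x n (row2 a b) <-> vge 0 a /\ vge n (b + x * a).
Proof. by rewrite /disc_lattice /= !row2E. Qed.

Definition disc x n : vclass K := hclass (disc_lattice x n).

Lemma homothetyP c L a : c != 0 -> homothety c L a <-> L (c^-1 *: a).
Proof.
move=> c0; split=> [[b Lb <-]|La].
  by rewrite scalerA mulVf // scale1r.
by exists (c^-1 *: a) => //; rewrite scalerA mulfV // scale1r.
Qed.

Lemma homothety1 L : homothety 1 L = L.
Proof.
by apply/seteqP; split => a; rewrite homothetyP ?oner_eq0 // invr1 scale1r.
Qed.

Lemma homothetyM c d L : homothety c (homothety d L) = homothety (c * d) L.
Proof.
rewrite /homothety image_comp; apply: eq_imagel => a _.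
by rewrite /= scalerA.
Qed.

Lemma hclass_self L : hclass L L.
Proof. by exists 1; rewrite ?homothety1 //= oner_eq0. Qed.

Lemma hclass_homothety c L : c != 0 -> hclass (homothety c L) = hclass L.
Proof.
move=> c0; apply/seteqP; split=> M [d d0 <-].
  exists (d * c); last by rewrite homothetyM.
  exact: mulf_neq0 d0 c0.
exists (d / c); last by rewrite homothetyM divfK.
by apply: mulf_neq0; rewrite ?invr_eq0.
Qed.

Lemma hclass_eqP L L' :
  hclass L = hclass L' <-> exists2 c, c != 0 & L = homothety c L'.
Proof.
split=> [E|[c c0 ->]]; last exact: hclass_homothety.
by have := hclass_self L; rewrite E => -[c c0 <-]; exists c.
Qed.

(** The inclusion is tested on the generators (1, -x) and (0, pi^n) of the first lattice. *)
Lemma disc_latticeP x y c m n k : val_eq c k ->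
  homothety c (disc_lattice x n) `<=` disc_lattice y m <->
  [/\ 0 <= k, m <= k + n & vge (m - k) (y - x)].
Proof.
move=> ck; have c0 := val_eq_neq0 ck.
have vc := val_eq_vge _ ck; split=> [sub|[k0 mk yx]].
  have in1 : disc_lattice x n (row2 1 (- x)).
    split; rewrite !row2E ?mulr1 ?addNr; last exact: vge_zero.
    by rewrite (val_eq_vge _ (val_eq1 C)).
  have in2 : disc_lattice x n (row2 0 (piF K ^ n)).
    split; rewrite !row2E; first exact: vge_zero.
    by rewrite mulr0 addr0 (val_eq_vge _ (val_eq_piX C n)).
  have [] := sub _ (ex_intro2 _ _ _ in1 erefl).
  rewrite !mxE /= mulr1 vc => k0; rewrite mulrN addrC mulrC -mulrBr.
  rewrite -[m in vge m](subrKC k) (vgeMl _ _ ck) => yx.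
  have [_] := sub _ (ex_intro2 _ _ _ in2 erefl).
  rewrite !mxE /= mulr0 mulr0 addr0.
  by rewrite (val_eq_vge _ (val_eqM ck (val_eq_piX C n))).
move=> _ [a [a0 a1] <-]; split; rewrite !mxE.
  by rewrite -[0]addr0; apply: vgeM => //; rewrite vc.
rewrite (lattice_shift c x); apply: vgeD.
  by apply: vge_trans mk _; rewrite (vgeMl _ _ ck).
rewrite -mulrA -[m](subrKC k) (vgeMl _ _ ck) -[m - k]addr0.
exact: vgeM.
Qed.

(** A homothety identifying the two lattices gives inclusions both ways, and these force its
    valuation k to satisfy 0 <= k and 0 <= - k. *)
Lemma disc_eqP x y m n : disc x n = disc y m <-> n = m /\ vge n (x - y).
Proof.
split=> [/hclass_eqP[c c0 E]|[<- xy]]; last first.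
  congr (hclass _); apply/seteqP; split; rewrite -[X in X `<=` _]homothety1;
    apply/(disc_latticeP _ _ _ _ (val_eq1 C)); rewrite subr0 add0r; split=> //.
  by rewrite -opprB vgeN.
have [k ck] := val_eq_ex C c0.
have E' : homothety c^-1 (disc_lattice x n) = disc_lattice y m.
  by rewrite E homothetyM mulVf // homothety1.
have : disc_lattice x n `<=` disc_lattice x n by [].
rewrite {1}E => /(disc_latticeP _ _ _ _ ck)[k0 nk xy].
have : disc_lattice y m `<=` disc_lattice y m by [].
rewrite -{1}E' => /(disc_latticeP _ _ _ _ (val_eqV ck))[k0' mk _].
have k_0 : k = 0 by lia.
by split; [lia|move: xy; rewrite k_0 subr0].
Qed.

Lemma disc_lattice_is_lattice x n : is_lattice (disc_lattice x n).
Proof.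
exists (mx2 1 (- x) 0 (piF K ^ n)).
  rewrite unitmx_mx2 mul1r mulr0 subr0 expfz_neq0 //; exact: piF_neq0.
apply/seteqP; split=> a.
  move=> [a0 a1]; exists (row2 (a 0 0) (piF K ^ (- n) * (a 0 1 + x * a 0 0))).
    move=> j /=; apply/(vge0 C).
    case: (ord2P j) => ->; rewrite !row2E //.
    by rewrite -[0](addNr n) (vgeMl _ _ (val_eq_piX C (- n))).
  apply: row2_ext; rewrite !mulmx2E !mx2E !row2E ?mulr1 ?mulr0 ?addr0 //.
  by rewrite -invr_expz disc_row_solve // expfz_neq0 // piF_neq0.
move=> [b /= bO <-]; split; rewrite !mulmx2E !mx2E ?mulr1 ?mulr0 ?addr0.
  by apply/vge0.
rewrite disc_row_eval -[n in vge n]addr0 (vgeMl _ _ (val_eq_piX C n)).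
by apply/vge0.
Qed.

Lemma is_vertex_disc x n : is_vertex (disc x n).
Proof.
by exists (disc_lattice x n) => //; exact: disc_lattice_is_lattice.
Qed.

End Tree.

(** * The action of GL_2 on discs *)

Section TreeAction.
Variables (R : realType) (K : finFieldType) (C : Cinfty R K).
Local Notation F := (Finf K).
Local Notation vge := (@vge R K C).
Local Notation val_eq := (@val_eq R K C).
Local Notation disc := (@disc R K C).
Implicit Types (x y c : F) (m n : int) (g h : 'M[F]_2) (L : set 'rV[F]_2)
  (u v w : vclass K).

Lemma rV2_mul (a : 'rV[F]_2) (M : 'M[F]_2) :
  a *m M = row2 (a 0 0 * M 0 0 + a 0 1 * M 1 0) (a 0 0 * M 0 1 + a 0 1 * M 1 1).
Proof. by apply: row2_ext; rewrite !mulmx2E !row2E. Qed.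

Lemma vge0_val_le x y m n : val_eq x m -> val_eq y n -> m <= n -> vge 0 (y / x).
Proof.
by move=> xm yn mn; rewrite (val_eq_vge _ (val_eqM yn (val_eqV xm))) subr_ge0.
Qed.

Definition lattice_of (M : 'M[F]_2) : set 'rV[F]_2 :=
  [set a *m M | a in [set a : 'rV[F]_2 | forall j, Oinf (a 0 j)]].

(** Row reduction: since M 1 0 / M 0 0 is integral, the lower left entry can be cleared. After
    division by M 0 0 the rows are (1, -x) and (0, d / M 0 0), and n is the valuation of the last
    entry. *)
Lemma lattice_of_disc (M : 'M[F]_2) : M \in unitmx -> M 0 0 != 0 ->
  vge 0 (M 1 0 / M 0 0) -> exists x n, hclass (lattice_of M) = disc x n.
Proof.
move=> uM M00 M10; move: (uM); rewrite unitmx2 => det0.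
pose d := M 1 1 - M 1 0 * M 0 1 / M 0 0.
have d0 : d / M 0 0 != 0 := row_reduce_neq0 M00 det0.
have [n dn] := val_eq_ex C d0.
exists (- M 0 1 / M 0 0), n; apply/hclass_eqP; exists (M 0 0); first exact: M00.
apply/seteqP; split=> a; rewrite homothetyP //.
  move=> [b /= bO <-]; rewrite rV2_mul.
  have b0 := (vge0 C _).2 (bO 0); have b1 := (vge0 C _).2 (bO 1).
  split; rewrite !scale_rV2 !row2E.
    rewrite (row_reduce_fst _ _ _ M00); apply: (vgeD b0).
    by rewrite -[0]addr0; apply: vgeM.
  rewrite (row_reduce_id _ _ _ _ _ M00) -/d mulrC -[n in vge n]addr0.
  by rewrite (vgeMl _ _ dn).
have [b ->] : exists b, a = b *m M by exists (a *m invmx M); rewrite (mulmxKV uM).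
move=> [a0 a1]; exists b; last by [].
move: a0 a1; rewrite rV2_mul !scale_rV2 !row2E.
rewrite (row_reduce_id _ _ _ _ _ M00) (row_reduce_fst _ _ _ M00) -/d => a0.
rewrite [X in vge n X]mulrC -[n in vge n]addr0 (vgeMl _ _ dn) => b1.
move=> j /=; apply/(vge0 C); case: (ord2P j) => ->; last exact: b1.
rewrite -[X in vge 0 X](addrK (b 0 1 * (M 1 0 / M 0 0))).
apply: vgeD; first exact: a0.
by rewrite vgeN -[0]addr0; apply: vgeM.
Qed.

Definition swap2 : 'M[F]_2 := mx2 0 1 1 0.

Lemma lattice_of_swap (M : 'M[F]_2) : lattice_of (swap2 *m M) = lattice_of M.
Proof.
suff sub (N : 'M[F]_2) : lattice_of (swap2 *m N) `<=` lattice_of N.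
  apply/seteqP; split; first exact: sub.
  have -> : lattice_of M = lattice_of (swap2 *m (swap2 *m M)); last exact: sub.
  rewrite mulmxA; suff -> : swap2 *m swap2 = 1%:M by rewrite mul1mx.
  by apply: mx2_ext; rewrite mulmx2E !mx2E !mxE ?mul0r ?mulr0 ?mulr1 ?addr0 ?add0r.
move=> _ [a aO <-]; exists (row2 (a 0 1) (a 0 0)).
  by move=> j /=; case: (ord2P j) => ->; rewrite row2E; apply: aO.
rewrite mulmxA; congr (_ *m _); apply: row2_ext;
  by rewrite mulmx2E !mx2E row2E ?mulr0 ?mulr1 ?addr0 ?add0r.
Qed.

(** Exchanging the rows keeps the lattice, so the entry of smaller valuation in the first column may
    be assumed to come first. *)
Lemma vertex_disc v : is_vertex v -> exists x n, v = disc x n.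
Proof.
move=> [L [M uM ->] ->]; rewrite -/(lattice_of M).
have uS : swap2 *m M \in unitmx.
  by rewrite unitmx_mul uM andbT unitmx_mx2 mulr0 mulr1 sub0r oppr_eq0 oner_eq0.
have S00 : (swap2 *m M) 0 0 = M 1 0.
  by rewrite mulmx2E !mx2E mul0r mul1r add0r.
have S10 : (swap2 *m M) 1 0 = M 0 0.
  by rewrite mulmx2E !mx2E mul0r mul1r addr0.
have [E|M00] := eqVneq (M 0 0) 0.
  rewrite -lattice_of_swap; apply: (lattice_of_disc uS); last first.
    by rewrite S10 E mul0r; apply: vge_zero.
  rewrite S00; apply: contraTneq uM => E'.
  by rewrite unitmx2 E E' mul0r mulr0 subrr eqxx.
have [E|M10] := eqVneq (M 1 0) 0.
  by apply: (lattice_of_disc uM M00); rewrite E mul0r; apply: vge_zero.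
have [m Mm] := val_eq_ex C M00; have [n Mn] := val_eq_ex C M10.
have [mn|/ltW mn] := leP m n.
  exact: lattice_of_disc uM M00 (vge0_val_le Mm Mn mn).
rewrite -lattice_of_swap; apply: (lattice_of_disc uS); rewrite S00 ?S10.
  exact: M10.
exact: vge0_val_le Mn Mm mn.
Qed.

Lemma actV_hclass g L :
  actV g (hclass L) = hclass [set a *m invmx g | a in L].
Proof.
apply/seteqP; split.
  move=> _ [_ [c c0 <-] <-]; exists c => //; rewrite /homothety !image_comp.
  by apply: eq_imagel => a _ /=; rewrite scalemxAl.
move=> _ [c c0 <-]; exists (homothety c L); first by exists c.
rewrite /homothety !image_comp; apply: eq_imagel => a _ /=.
by rewrite scalemxAl.
Qed.

Lemma actV_comp g h v : GL2 g -> GL2 h -> actV (g *m h) v = actV g (actV h v).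
Proof.
move=> Gg Gh; have ghE := invmxM Gg Gh.
rewrite /actV image_comp; apply: eq_imagel => L _ /=.
by rewrite image_comp; apply: eq_imagel => a _ /=; rewrite ghE mulmxA.
Qed.

Lemma actV1 v : actV 1%:M v = v.
Proof.
rewrite /actV -[RHS]image_id; apply: eq_imagel => L _ /=.
by rewrite -[RHS]image_id; apply: eq_imagel => a _; rewrite invmx1 mulmx1.
Qed.

Lemma actVK g v : GL2 g -> actV (invmx g) (actV g v) = v.
Proof.
by move=> Gg; rewrite -(actV_comp _ (GL2_inv Gg) Gg) (mulVmx Gg) actV1.
Qed.

Lemma actVKV g v : GL2 g -> actV g (actV (invmx g) v) = v.
Proof.
by move=> Gg; rewrite -(actV_comp _ Gg (GL2_inv Gg)) (mulmxV Gg) actV1.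
Qed.

Lemma actV_inj g u v : GL2 g -> actV g u = actV g v -> u = v.
Proof. by move=> Gg E; rewrite -(actVK u Gg) E (actVK v Gg). Qed.

Lemma image_mul_inv g L a : GL2 g ->
  [set b *m invmx g | b in L] a <-> L (a *m g).
Proof.
move=> Gg; split=> [[b Lb <-]|La]; first by rewrite (mulmxKV Gg).
by exists (a *m g); rewrite ?(mulmxK Gg).
Qed.

(** The form (u, v) g evaluated at x is d times (u, v) evaluated at (a x + b) / d, so the action on
    classes of lattices is the action on the points of the discs. *)
Lemma actV_affine (a b d : F) x n k : a != 0 -> d != 0 -> val_eq (a / d) k ->
  actV (mx2 a b 0 d) (disc x n) = disc ((a * x + b) / d) (k + n).
Proof.
move=> a0 d0 adk; rewrite actV_hclass; apply/hclass_eqP.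
have ai0 : a^-1 != 0 := invr_neq0 a0.
have Gg : GL2 (mx2 a b 0 d).
  by rewrite /GL2 /= unitmx_mx2 mulr0 subr0; exact: mulf_neq0 a0 d0.
(* (u, v) g has first entry a u; the factor a^-1 restores the normalization |u| <= 1. *)
exists a^-1; first exact: ai0.
rewrite eqEsubset; split=> y.
  move/(image_mul_inv _ _ Gg); rewrite rV2_mul !mx2E mulr0 addr0.
  move/disc_lattice_row2 => [y0 y1].
  apply/(homothetyP _ _ ai0); rewrite invrK scale_row2; apply/disc_lattice_row2.
  by rewrite (affine_row _ _ _ _ _ d0) (vgeMl _ _ adk) mulrC.
move/(homothetyP _ _ ai0); rewrite invrK scale_row2.
move/disc_lattice_row2; rewrite (affine_row _ _ _ _ _ d0) (vgeMl _ _ adk).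
move=> [y0 y1]; apply/(image_mul_inv _ _ Gg).
rewrite rV2_mul !mx2E mulr0 addr0; apply/disc_lattice_row2; split=> //.
by rewrite mulrC.
Qed.

Lemma GL2_swap2 : GL2 swap2.
Proof.
by rewrite /GL2 /= unitmx_mx2 mulr0 mulr1 sub0r oppr_eq0 oner_eq0.
Qed.

Lemma piXz_neq0 n : piF K ^ n != 0.
Proof. by rewrite expfz_neq0 // piF_neq0. Qed.

(** The matrix of z |-> 1 / z exchanges the two coefficients of a form; dividing by pi^n restores
    the normalization |u| <= 1. *)
Lemma actV_swap n : actV swap2 (disc 0 n) = disc 0 (- n).
Proof.
rewrite actV_hclass; apply/hclass_eqP.
have p0 := piXz_neq0 n; exists (piF K ^ n); first exact: p0.
have pn := val_eqV (val_eq_piX C n).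
rewrite eqEsubset; split=> y.
  move/(image_mul_inv _ _ GL2_swap2); rewrite rV2_mul !mx2E !mulr0 !mulr1 addr0 add0r.
  move/disc_lattice_row2; rewrite mul0r addr0 => -[y1 y0].
  apply/(homothetyP _ _ p0); rewrite scale_row2; apply/disc_lattice_row2.
  rewrite mul0r addr0 -{1}[0](addNr n) (vgeMl _ _ pn).
  by rewrite -[- n]addr0 (vgeMl _ _ pn).
move/(homothetyP _ _ p0); rewrite scale_row2; move/disc_lattice_row2.
rewrite mul0r addr0 -{1}[0](addNr n) (vgeMl _ _ pn).
rewrite -[- n]addr0 (vgeMl _ _ pn) => -[y0 y1].
apply/(image_mul_inv _ _ GL2_swap2).
rewrite rV2_mul !mx2E !mulr0 !mulr1 addr0 add0r; apply/disc_lattice_row2.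
by rewrite mul0r addr0.
Qed.

(** Dividing by pi^m moves the divisibility condition to the second coordinate, whence the sign: the
    ray towards infinity consists of growing discs around 0. *)
Lemma vstd_disc m : vstd m = disc 0 (- m).
Proof.
apply/hclass_eqP; have p0 := piXz_neq0 m; exists (piF K ^ m); first exact: p0.
have pm := val_eqV (val_eq_piX C m).
have stdE a b : (piF K ^ m * a) *: delta_mx 0 0 + b *: delta_mx 0 1
    = row2 (piF K ^ m * a) b :> 'rV[F]_2.
  by apply: row2_ext; rewrite row2E !mxE /= ?mulr1 ?mulr0 ?addr0 ?add0r.
rewrite eqEsubset; split=> y.
  move=> [a aO [b bO <-]]; apply/(homothetyP _ _ p0).
  rewrite stdE scale_row2 !row2E; apply/disc_lattice_row2.
  rewrite mul0r addr0 -[- m]addr0 (vgeMl _ _ pm) (mulKf p0).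
  by split; apply/vge0.
move/(homothetyP _ _ p0); rewrite scale_row2; move/disc_lattice_row2.
rewrite mul0r addr0 -[- m]addr0 (vgeMl _ _ pm) => -[/vge0 y0 /vge0 y1].
exists ((piF K ^ m)^-1 * y 0 0); first exact: y0.
exists (y 0 1); first exact: y1.
by rewrite stdE (mulVKf p0); apply: row2_ext; rewrite row2E.
Qed.

End TreeAction.

Section MoebiusAtInfinity.
Variable F : fieldType.
Implicit Types a b c d x y : F.

Lemma moebius_root a b c d : d != 0 ->
  (a * (c / d) + b == 0) = (a * c + b * d == 0).
Proof.
move=> d0; rewrite -(mulIr_eq0 _ (mulIf d0)) mulrDl; congr (_ + _ == 0).
by rewrite -mulrA divfK.
Qed.

Lemma moebius_ratio a b a' b' c d : d != 0 -> a' * c + b' * d != 0 ->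
  (a * (c / d) + b) / (a' * (c / d) + b') = (a * c + b * d) / (a' * c + b' * d).
Proof.
move=> d0 den; have den' : a' * (c / d) + b' != 0 by rewrite moebius_root.
by field; rewrite d0 den.
Qed.

End MoebiusAtInfinity.

(** * Adjacent vertices *)

Section Adjacency.
Variables (R : realType) (K : finFieldType) (C : Cinfty R K).
Local Notation F := (Finf K).
Local Notation vge := (@vge R K C).
Local Notation val_eq := (@val_eq R K C).
Local Notation disc := (@disc R K C).
Local Notation disc_lattice := (@disc_lattice R K C).
Implicit Types (x y c : F) (m n : int) (g h : 'M[F]_2) (L : set 'rV[F]_2)
  (u v w : vclass K).

Lemma homothety_sub c L L' : c != 0 ->
  homothety c L `<=` L' <-> L `<=` homothety c^-1 L'.
Proof.
move=> c0; have ci0 := invr_neq0 c0; split=> sub a.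
  move=> La; apply/(homothetyP _ _ ci0); rewrite invrK; apply: sub.
  by exists a.
by move=> [b /sub + <-] => /(homothetyP _ _ ci0); rewrite invrK.
Qed.

Lemma homothetyS c L L' : L `<=` L' -> homothety c L `<=` homothety c L'.
Proof. exact: image_subset. Qed.

Lemma homothety_inj c L L' : c != 0 -> homothety c L = homothety c L' -> L = L'.
Proof.
move=> c0 /(congr1 (homothety c^-1)).
by rewrite !homothetyM (mulVf c0) !homothety1.
Qed.

Lemma is_lattice_homothety c L :
  c != 0 -> is_lattice L -> is_lattice (homothety c L).
Proof.
move=> c0 [M uM ->]; exists (c *: M).
  rewrite unitmxE detZ unitfE mulf_eq0 expf_eq0 (negbTE c0) /=.
  by rewrite -unitfE -unitmxE.
rewrite /homothety image_comp; apply: eq_imagel => a _ /=.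
by rewrite scalemxAr.
Qed.

Lemma adjacent_sym v w : Defs.adjacent v w -> Defs.adjacent w v.
Proof.
move=> [L [L' [[latL latL' -> ->] [piLL' piL_L' L'L L'_L]]]].
have p0 := piF_neq0 K.
exists L', (homothety (piF K) L); split.
  split=> //; first exact: is_lattice_homothety.
  by rewrite hclass_homothety.
by split => //; [exact: homothetyS|move/(homothety_inj p0)].
Qed.

Lemma adjacent_disc x n : Defs.adjacent (disc x n) (disc x (n + 1)).
Proof.
have pi1 := val_eq_pi C; have one := val_eq1 C.
exists (disc_lattice x n), (disc_lattice x (n + 1)); split.
  by split=> //; exact: disc_lattice_is_lattice.
split.
- apply/(disc_latticeP _ _ _ _ pi1); split=> //; first by rewrite addrC.
  by rewrite subrr; exact: vge_zero.
- move=> E; have : disc_lattice x (n + 1) `<=` disc_lattice x (n + 1) by [].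
  rewrite -{2}E -[X in X `<=` _]homothety1 -[piF K]invrK -homothety_sub.
    rewrite homothetyM mulr1 => /(disc_latticeP _ _ _ _ (val_eqV pi1))[].
    by [].
  by rewrite invr_eq0 piF_neq0.
- rewrite -[X in X `<=` _]homothety1; apply/(disc_latticeP _ _ _ _ one).
  split=> //; first by rewrite add0r lerDl.
  by rewrite subrr; exact: vge_zero.
- move=> E; have : disc_lattice x n `<=` disc_lattice x n by [].
  rewrite -{2}E -[X in X `<=` _]homothety1.
  by move/(disc_latticeP _ _ _ _ one) => [_]; rewrite add0r; lia.
Qed.

(** For the underlying disc lattices, the chain pi L, L', L forces the valuation k of the ratio of
    the homothety factors to be 0 or 1. In both cases the radii differ by at most one step, and
    strictness of the chain excludes equal radii. *)
Lemma adjacentP v w : Defs.adjacent v w -> exists x n,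
  (v = disc x n /\ w = disc x (n + 1)) \/ (v = disc x (n + 1) /\ w = disc x n).
Proof.
move=> [L [L' [[latL latL' -> ->] [piLL' piL_L' L'L L'_L]]]].
have [x [n Ex]] : exists x n, hclass L = disc x n.
  by apply: vertex_disc; exists L.
have [y [m Ey]] : exists x n, hclass L' = disc x n.
  by apply: vertex_disc; exists L'.
move/hclass_eqP: (Ex) => [c c0 EL]; move/hclass_eqP: (Ey) => [c' c'0 EL'].
have [k dk] := val_eq_ex C (mulf_neq0 c'0 (invr_neq0 c0)).
have ic0 := invr_neq0 c0; have ic'0 := invr_neq0 c'0.
have dk' : val_eq (c / c') (- k).
  by have := val_eqV dk; rewrite invfM invrK mulrC.
have pdk := val_eqM (val_eq_pi C) dk'.
have pdk' := val_eqM dk (val_eqV (val_eq_pi C)).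
have subLL' : homothety (c' / c) (disc_lattice y m) `<=` disc_lattice x n.
  rewrite mulrC -homothetyM -EL'; apply/(homothety_sub _ _ ic0).
  by rewrite invrK -EL.
have subL'L : homothety (piF K * (c / c')) (disc_lattice x n)
    `<=` disc_lattice y m.
  rewrite mulrA mulrC -homothetyM; apply/(homothety_sub _ _ ic'0).
  by rewrite invrK -EL' -homothetyM -EL.
have Lsub : homothety (c / c') (disc_lattice x n) `<=` disc_lattice y m -> False.
  move=> sub; apply: L'_L; apply/seteqP; split=> //; rewrite EL EL'.
  rewrite -[c']invrK; apply/(homothety_sub _ _ ic'0).
  by rewrite homothetyM mulrC.
have L'sub : homothety (c' / c / piF K) (disc_lattice y m)
    `<=` disc_lattice x n -> False.
  move=> sub; apply: piL_L'; apply/seteqP; split=> //; rewrite EL EL' homothetyM.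
  have pc0 := mulf_neq0 (piF_neq0 K) c0.
  rewrite -[piF K * c]invrK; apply/(homothety_sub _ _ (invr_neq0 pc0)).
  rewrite homothetyM; suff -> : (piF K * c)^-1 * c' = c' / c / piF K by [].
  by rewrite invfM mulrC mulrCA mulrC -mulrA.
move/(disc_latticeP _ _ _ _ dk): subLL' => [k0 nm xy].
move/(disc_latticeP _ _ _ _ pdk): subL'L => [k1 mn yx].
have xyC j : vge j (x - y) = vge j (y - x) by rewrite -opprB vgeN.
have [k_0|k_1] : k = 0 \/ k = 1 by lia.
  rewrite k_0 in dk' nm xy yx mn; rewrite subr0 in xy.
  have [mn1|mn1] : m = n \/ m = n + 1 by lia.
    case: Lsub; apply/(disc_latticeP _ _ _ _ dk').
    by rewrite mn1 oppr0 add0r subr0 -xyC.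
  exists y, n; left; rewrite Ex Ey mn1; split=> //.
  exact/disc_eqP.
rewrite k_1 in pdk' nm xy yx mn.
have [mn1|mn1] : m = n \/ n = m + 1 by lia.
  case: L'sub; apply/(disc_latticeP _ _ _ _ pdk').
  rewrite mn1 subrr add0r subr0; split=> //; rewrite xyC.
  by rewrite mn1 subrr subr0 in yx.
exists x, m; right; rewrite Ex Ey mn1; split=> //.
by apply/disc_eqP; split=> //; rewrite mn1 addrK in xy; rewrite -xyC.
Qed.

Lemma adjacent_vertex v w : Defs.adjacent v w -> is_vertex v.
Proof. by move=> [L [L' [[latL _ -> _] _]]]; exists L. Qed.

Lemma adjacent_neq v w : Defs.adjacent v w -> v <> w.
Proof.
move=> /adjacentP[x [n [[-> ->]|[-> ->]]]] /disc_eqP[]; lia.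
Qed.

Lemma is_lattice_mul g L : GL2 g -> is_lattice L ->
  is_lattice [set a *m invmx g | a in L].
Proof.
move=> Gg [M uM ->]; exists (M *m invmx g).
  by rewrite unitmx_mul uM; exact: GL2_inv.
by rewrite image_comp; apply: eq_imagel => a _ /=; rewrite mulmxA.
Qed.

Lemma is_vertex_act g v : GL2 g -> is_vertex v -> is_vertex (actV g v).
Proof.
move=> Gg [L latL ->]; rewrite actV_hclass.
by exists [set a *m invmx g | a in L] => //; exact: is_lattice_mul.
Qed.

Lemma adjacent_act g v w : GL2 g -> Defs.adjacent v w -> Defs.adjacent (actV g v) (actV g w).
Proof.
move=> Gg [L [L' [[latL latL' -> ->] [piLL' piL_L' L'L L'_L]]]].
pose act M : set 'rV[F]_2 := [set a *m invmx g | a in M].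
have act_inj M M' : act M = act M' -> M = M'.
  move=> E; have inM N a : N a <-> act N (a *m invmx g).
    by split; rewrite /act (image_mul_inv _ _ Gg) (mulmxKV Gg).
  by apply/seteqP; split=> a; rewrite (inM M) (inM M') E.
have actH c M : homothety c (act M) = act (homothety c M).
  rewrite /homothety /act !image_comp; apply: eq_imagel => a _ /=.
  by rewrite scalemxAl.
rewrite !actV_hclass; exists (act L), (act L'); split.
  by split=> //; exact: is_lattice_mul.
rewrite actH; split; try exact: image_subset.
- by move/act_inj.
- by move/act_inj.
Qed.

End Adjacency.

(** * Lines in the tree and the geodesic from 0 to infinity *)

Section Geodesics.
Variables (R : realType) (K : finFieldType) (C : Cinfty R K).
Local Notation F := (Finf K).
Local Notation vge := (@vge R K C).
Local Notation val_eq := (@val_eq R K C).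
Local Notation disc := (@disc R K C).
Implicit Types (x y c : F) (m n d : int) (g h : 'M[F]_2) (u v w : vclass K)
  (p : tpoint R K).

(** [v] is at distance [d] from the geodesic joining 0 and infinity. *)
Definition apt_dist v d := exists x n, v = disc x n /\
  (d = 0 /\ vge n x \/ exists k, [/\ val_eq x k, k < n & d = n - k]).

Lemma apt_dist_uniq v d d' : apt_dist v d -> apt_dist v d' -> d = d'.
Proof.
move=> [x [n [-> xd]]] [y [m [/disc_eqP[<- xy] yd]]].
have yx : vge n (y - x) by rewrite -opprB vgeN.
case: xd yd => [[-> xn]|[k [xk kn ->]]] [[-> yn] //|[k' [yk kn' ->]]].
- by move: xn; rewrite (val_eq_vge _ (val_eq_perturb yx yk kn')); lia.
- by move: yn; rewrite (val_eq_vge _ (val_eq_perturb xy xk kn)); lia.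
- by rewrite (val_eq_inj (val_eq_perturb xy xk kn) yk).
Qed.

Lemma apt_dist_disc v : is_vertex v -> exists2 d : int, 0 <= d & apt_dist v d.
Proof.
move/(vertex_disc C) => [x [n ->]].
have [xn|xn] := boolP (vge n x); first by exists 0 => //; exists x, n; split=> //; left.
have [k xk] : exists k, val_eq x k.
  by apply: val_eq_ex; apply: contraNneq xn => ->; exact: vge_zero.
move: xn; rewrite (val_eq_vge _ xk) -ltNge => kn.
by exists (n - k); [lia|exists x, n; split=> //; right; exists k].
Qed.

Lemma apt_dist0 v : apt_dist v 0 -> exists n, v = disc 0 n.
Proof.
move=> [x [n [-> [[_ xn]|[k [_ kn /eqP]]]]]]; last by rewrite eq_sym subr_eq0; lia.
by exists n; apply/disc_eqP; rewrite subr0.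
Qed.

Lemma apt_dist_std n : apt_dist (disc 0 n) 0.
Proof. by exists 0, n; split=> //; left; split=> //; exact: vge_zero. Qed.

(** A disc at positive distance does not contain 0. Its unique enlargement by one step is one
    closer, while all points of a smaller disc keep the valuation of the centre, so every smaller
    disc is one further away. *)
Lemma apt_dist_step v d : 0 < d -> apt_dist v d -> exists2 u, apt_dist u (d - 1) &
  forall w, Defs.adjacent v w -> w = u \/ apt_dist w (d + 1).
Proof.
move=> d0 [x [n [-> [[d_0 _]|[k [xk kn dE]]]]]]; first by rewrite d_0 in d0.
exists (disc x (n - 1)).
  exists x, (n - 1); split=> //; have [kn1|kn1] : k = n - 1 \/ k < n - 1 by lia.
    by left; rewrite (val_eq_vge _ xk) kn1 lexx dE; split=> //; lia.
  by right; exists k; split=> //; rewrite dE; lia.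
move=> w /(adjacentP C)[x' [n' [[/disc_eqP[<- xx'] ->]|[/disc_eqP[-> xx'] ->]]]].
  right; exists x', (n + 1); split=> //; right; exists k; split.
  - exact: val_eq_perturb xx' xk kn.
  - by lia.
  - by rewrite dE; lia.
left; apply/disc_eqP; rewrite addrK; split=> //; rewrite -opprB vgeN.
by apply: vge_trans xx'; lia.
Qed.

(** Once the path moves away, the only neighbour nearer to the apartment is the vertex just left,
    and backtracking is excluded. *)
Lemma apt_dist_escape (s : nat -> vclass K) d : 0 < d ->
  (forall j, Defs.adjacent (s j) (s j.+1)) -> (forall j, s j <> s j.+2) ->
  apt_dist (s 0) d -> apt_dist (s 1%N) (d + 1) ->
  forall j, apt_dist (s j) (d + j%:Z).
Proof.
move=> d0 adj nb s0 s1 j.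
suff [] : apt_dist (s j) (d + j%:Z) /\ apt_dist (s j.+1) (d + j.+1%:Z) by [].
elim: j => [|j [IH1 IH2]]; first by rewrite addr0.
split=> //; have dj0 : 0 < d + j.+1%:Z by lia.
have [u _ near_u] := apt_dist_step dj0 IH2.
have [Eu|bad] := near_u _ (adjacent_sym (adj j)); last first.
  by have := apt_dist_uniq IH1 bad; lia.
have [Eu'|] := near_u _ (adj j.+1); first by case: (nb j); rewrite Eu.
by congr (apt_dist _ _); lia.
Qed.

(** At a vertex off the apartment at most one of the two distinct neighbours on the line is nearer,
    so in some direction the line moves away for ever; but both of its ends lie in the apartment. *)
Lemma line_apt (w : int -> vclass K) (N : nat) : is_line w ->
  (forall n : nat, (N <= n)%N -> apt_dist (w n%:Z) 0 /\ apt_dist (w (- n%:Z)) 0) ->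
  forall n, apt_dist (w n) 0.
Proof.
move=> lw ends n; have [d d_ge0 wd] : exists2 d : int, 0 <= d & apt_dist (w n) d.
  by apply: apt_dist_disc; exact: adjacent_vertex (lw n).1.
have [E|d0] : 0 = d \/ 0 < d by lia.
  by rewrite E.
have [u _ near_u] := apt_dist_step d0 wd.
have adj_r := (lw n).1; have adj_l := (lw (n - 1)).1; rewrite subrK in adj_l.
(* [e] is the direction of travel along the line. *)
have far (e : int) (s : nat -> vclass K) : (forall j, s j = w (n + e * j%:Z)) ->
    e = 1 \/ e = -1 -> apt_dist (s 1%N) (d + 1) -> False.
  move=> sE e1 s1.
  have esc := @apt_dist_escape s d d0 _ _ _ s1.
  have {}esc j : apt_dist (s j) (d + j%:Z).
    apply: esc => [i|i|]; last by rewrite sE mulr0 addr0.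
      rewrite !sE; case: e1 => ->.
        have := (lw (n + 1 * i%:Z)).1; congr (Defs.adjacent _ (w _)); lia.
      have := (lw (n + -1 * i.+1%:Z)).1 => /adjacent_sym.
      by congr (Defs.adjacent (w _) _); lia.
    rewrite !sE; have [_] := lw (n + e * i.+1%:Z); case: e1 => -> H E; apply: H.
      by move: E; congr (w _ = w _); lia.
    by move/esym: E; congr (w _ = w _); lia.
  (* Enough steps for n + e j to lie in an end of the line, in either direction. *)
  pose j := (N + `|n|)%N.
  have := esc j; rewrite sE; suff w0 : apt_dist (w (n + e * j%:Z)) 0.
    by move/(apt_dist_uniq w0); rewrite /j; lia.
  case: e1 => ->.
    have [|+ _] := ends (absz (n + 1 * j%:Z)); first by rewrite /j; lia.
    by congr (apt_dist (w _) _); rewrite /j; lia.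
  have [|_] := ends (absz (n + -1 * j%:Z)); first by rewrite /j; lia.
  by congr (apt_dist (w _) _); rewrite /j; lia.
have [Er|Hr] := near_u _ adj_r; last first.
  by case: (far 1 _ (fun=> erefl) (or_introl erefl) Hr).
have [El|Hl] := near_u _ (adjacent_sym adj_l); last first.
  by case: (far (-1) _ (fun=> erefl) (or_intror erefl) Hl).
by case: (lw n) => _; rewrite El Er.
Qed.

Lemma ex_vge x : exists n, vge n x.
Proof.
have [->|/(val_eq_ex C)[n xn]] := eqVneq x 0; first by exists 0; exact: vge_zero.
by exists n; rewrite (val_eq_vge _ xn).
Qed.

Lemma mx2_eta g : g = mx2 (g 0 0) (g 0 1) (g 1 0) (g 1 1).
Proof. by apply: mx2_ext; rewrite mx2E. Qed.

(** Once the disc is large enough to contain b / d, the translation no longer matters. *)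
Lemma affine_ray (a b d : F) : a != 0 -> d != 0 -> exists k (N : nat),
  forall n : nat, (N <= n)%N -> actV (mx2 a b 0 d) (vstd n%:Z) = disc 0 (k - n%:Z).
Proof.
move=> a0 d0; have [k adk] := val_eq_ex C (mulf_neq0 a0 (invr_neq0 d0)).
have [j bj] := ex_vge (b / d); exists k, `|k - j|%N => n Nn.
rewrite (vstd_disc C) (actV_affine _ _ _ a0 d0 adk) mulr0 add0r.
by apply/disc_eqP; rewrite subr0; split=> //; apply: vge_trans bj; lia.
Qed.

Lemma ray_represents_infty (r : nat -> vclass K) : ray_represents r None ->
  exists N : nat, forall n : nat, (N <= n)%N -> apt_dist (r n) 0.
Proof.
move=> [g [Gg /= g10 [m [m' rg]]]].
move: g10; case: eqVneq => // g10 _.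
move: (Gg); rewrite /GL2 /= unitmx2 g10 mulr0 subr0 mulf_eq0 negb_or => /andP[a0 d0].
have [k [N HN]] := affine_ray (g 0 1) a0 d0.
exists (N + m)%N => n Nn; rewrite -(subnK (leq_trans (leq_addl _ _) Nn)) rg.
rewrite [g]mx2_eta g10 HN; last by lia.
exact: apt_dist_std.
Qed.

(** A matrix sending infinity to 0 is the swap composed with an affine map. *)
Lemma ray_represents_zero (r : nat -> vclass K) : ray_represents r (Some 0) ->
  exists N : nat, forall n : nat, (N <= n)%N -> apt_dist (r n) 0.
Proof.
move=> [g [Gg /= g00 [m [m' rg]]]].
move: g00; case: eqVneq => // g10 [/eqP]; rewrite mulf_eq0 invr_eq0 (negbTE g10) orbF.
move=> /eqP g00; move: (Gg); rewrite /GL2 /= unitmx2 g00 mul0r sub0r oppr_eq0.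
rewrite mulf_eq0 negb_or => /andP[d0 _].
have gE : g = swap2 K *m mx2 (g 1 0) (g 1 1) 0 (g 0 1).
  apply: mx2_ext; rewrite mulmx2E !mx2E ?mul0r ?mul1r ?addr0 ?add0r //.
have [k [N HN]] := affine_ray (g 1 1) g10 d0.
have Gt : GL2 (mx2 (g 1 0) (g 1 1) 0 (g 0 1)).
  by rewrite /GL2 /= unitmx_mx2 mulr0 subr0; exact: mulf_neq0 g10 d0.
exists (N + m)%N => n Nn; rewrite -(subnK (leq_trans (leq_addl _ _) Nn)) rg.
rewrite gE (actV_comp _ (GL2_swap2 K) Gt) HN; last by lia.
rewrite actV_swap; exact: apt_dist_std.
Qed.

Lemma vpoint_self v : vpoint R v v = 1.
Proof. by rewrite /vpoint asboolT. Qed.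

Lemma vpoint_neq u v : u <> v -> vpoint R v u = 0.
Proof. by move=> uv; rewrite /vpoint asboolF. Qed.

Lemma bary0 v w : bary 0 v w = vpoint R v.
Proof. by apply/funext => u; rewrite /bary subr0 mul1r mul0r addr0. Qed.

Lemma bary1 v w : bary 1 v w = vpoint R w.
Proof. by apply/funext => u; rewrite /bary subrr mul1r mul0r add0r. Qed.

Lemma bary_sym (t : R) v w : bary t v w = bary (1 - t) w v.
Proof. by apply/funext => u; rewrite /bary subKr addrC. Qed.

Lemma geodesic_std_vertex v :
  geodesic (Some 0) None (vpoint R v) -> exists n, v = disc 0 n.
Proof.
move=> [w [lw /ray_represents_zero[N0 H0] /ray_represents_infty[N1 H1]]].
move=> [n [t [_ E]]].
have aw i : apt_dist (w i) 0.
  apply: (@line_apt w (N0 + N1)%N) => // j Nj; split; [apply: H1|apply: H0]; lia.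
(* A vertex other than the two ends of the edge has coordinate 0 in [bary], but coordinate 1 in its
   own [vpoint]. *)
apply: apt_dist0; have [->|vn] := pselect (v = w n); first exact: aw.
have [->|vn1] := pselect (v = w (n + 1)); first exact: aw.
have := congr1 (fun f => f v) E; rewrite vpoint_self /bary !vpoint_neq //.
by rewrite !mulr0 addr0 => /eqP; rewrite oner_eq0.
Qed.

Lemma geodesic_std m (t : R) : 0 <= t <= 1 ->
  geodesic (Some 0) None (bary t (disc 0 m) (disc 0 (m + 1))).
Proof.
move=> t01; exists (fun n => disc 0 (- n)); split.
- move=> n; split.
    have := adjacent_disc C 0 (- (n + 1)); rewrite opprD addrNK.
    by move/adjacent_sym.
  by move/disc_eqP => [] ; lia.
- exists (swap2 K); split; first exact: GL2_swap2.
    by rewrite /= !mx2E oner_eq0 mul0r.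
  by exists 0, 0 => n; rewrite (vstd_disc C) actV_swap !addn0.
- exists 1%:M; split; first by rewrite /GL2 /= unitmx1.
    by rewrite /mobP mxE /= eqxx.
  by exists 0, 0 => n; rewrite (vstd_disc C) actV1 !addn0.
(* The line from 0 to infinity runs through growing discs, so it traverses this edge backwards. *)
- exists (- m - 1), (1 - t); split; first by lra.
  by rewrite [LHS]bary_sym; congr (bary _ (disc _ _) (disc _ _)); lia.
Qed.

Lemma actT_bary g (t : R) v w : GL2 g ->
  actT g (bary t v w) = bary t (actV g v) (actV g w).
Proof.
move=> Gg; apply/funext => u; rewrite /actT /bary.
suff vE v' : vpoint R v' (actV (invmx g) u) = vpoint R (actV g v') u by rewrite !vE.
have [->|uv] := pselect (u = actV g v'); first by rewrite actVK // !vpoint_self.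
rewrite !vpoint_neq // => E; apply: uv; by rewrite -E actVKV.
Qed.

Lemma actT_vpoint g v : GL2 g -> actT g (vpoint R v) = vpoint R (actV g v).
Proof. by move=> Gg; rewrite -(bary0 v v) actT_bary // bary0. Qed.

Lemma mobP_infty_comp g h : GL2 g -> GL2 h ->
  mobP (g *m h) None = mobP g (mobP h None).
Proof.
move=> Gg Gh; rewrite /mobP !mulmx2E; have [h10|h10] := eqVneq (h 1 0) 0.
  have h00 : h 0 0 != 0.
    move: Gh; rewrite /GL2 /= unitmx2 h10 mulr0 subr0 mulf_eq0 negb_or.
    by move=> /andP[h00 _]; exact: h00.
  rewrite h10 !mulr0 !addr0 mulf_eq0 (negbTE h00) orbF.
  case: eqVneq => [//|g10]; by rewrite invfM mulrACA (divff h00) mulr1.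
rewrite (moebius_root _ _ _ h10); case: eqVneq => // den.
by rewrite (moebius_ratio _ _ h10 den).
Qed.

Lemma ray_represents_act g (r : nat -> vclass K) (a : P1 K) : GL2 g ->
  ray_represents r a -> ray_represents (fun n : nat => actV g (r n)) (mobP g a).
Proof.
move=> Gg [h [Gh <- [m [m' rh]]]]; exists (g *m h); split.
- exact: GL2_mul.
- exact: mobP_infty_comp.
- by exists m, m' => n; rewrite rh (actV_comp _ Gg Gh).
Qed.

Lemma geodesic_act g (a b : P1 K) p : GL2 g -> geodesic a b p ->
  geodesic (mobP g a) (mobP g b) (actT g p).
Proof.
move=> Gg [w [lw wa wb [n [t [t01 ->]]]]].
exists (fun n => actV g (w n)); split.
- move=> i; have [adj nb] := lw i; split; first exact: adjacent_act.
  by move/(actV_inj Gg).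
- exact: ray_represents_act wa.
- exact: ray_represents_act wb.
- by exists n, t; rewrite actT_bary.
Qed.

End Geodesics.

(** * Path lengths and the distance to the vertices *)

Section Distances.
Variables (R : realType) (K : finFieldType) (C : Cinfty R K).
Local Notation F := (Finf K).
Local Notation disc := (@disc R K C).
Implicit Types (m n s t : R) (g h : 'M[F]_2) (u v w : vclass K)
  (p x y z : tpoint R K) (A : set (tpoint R K)).

Lemma edge_step_ge0 x y m : edge_step x y m -> 0 <= m.
Proof. by move=> [v [w [s [t [_ _ _ [_ _ ->]]]]]]. Qed.

Lemma path_length_ge0 x y m : path_length x y m -> 0 <= m.
Proof. by elim=> // {}x {}y z {}m n /edge_step_ge0 m0 _; apply: addr_ge0. Qed.

Lemma path_length_trans x y z m n :
  path_length x y m -> path_length y z n -> path_length x z (m + n).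
Proof.
elim=> [?|{}x y' {}y {}m m' step _ IH /IH]; first by rewrite add0r.
by rewrite -addrA; apply: path_cons.
Qed.

Lemma path_length_edge x y m : edge_step x y m -> path_length x y m.
Proof. by move=> xy; rewrite -[m]addr0; apply: path_cons xy (path_nil _). Qed.

Lemma path_length_act g x y m : GL2 g ->
  path_length x y m -> path_length (actT g x) (actT g y) m.
Proof.
move=> Gg; elim=> [?|{}x {}y z {}m n [v [w [s [t [adj s01 t01 [-> -> ->]]]]]] _ IH].
  exact: path_nil.
apply: path_cons IH; exists (actV g v), (actV g w), s, t.
by split=> //; [exact: adjacent_act|rewrite !actT_bary].
Qed.

Lemma distT_ge0 x y : 0 <= distT x y.
Proof.
rewrite /distT; have [->|/set0P ne] := eqVneq [set m | path_length x y m] set0.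
  by rewrite inf0.
by apply: lb_le_inf => // m /path_length_ge0.
Qed.

Lemma distT_le x y m : path_length x y m -> distT x y <= m.
Proof.
by move=> xy; apply: ge_inf => //; exists 0 => n /path_length_ge0.
Qed.

Lemma dist_to_le x A y m : A y -> path_length x y m -> dist_to x A <= m.
Proof.
move=> Ay xy; apply: le_trans (distT_le xy).
by apply: ge_inf; [exists 0 => _ [z _ <-]; exact: distT_ge0|exists y].
Qed.

(** This is the source of lower bounds for path lengths: along an edge a barycentric coordinate
    changes at rate at most 1. *)
Lemma coord_lipschitz x y m u : path_length x y m -> `|x u - y u| <= m.
Proof.
elim=> [?|{}x {}y z {}m n [v [w [s [t [adj s01 t01 [-> -> ->]]]]]] _ IH].
  by rewrite subrr normr0.
rewrite -(subrKA (bary t v w u)); apply: le_trans (ler_normD _ _) (lerD _ IH).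
rewrite /bary; set a := vpoint R v u; set b := vpoint R w u.
have -> : (1 - s) * a + s * b - ((1 - t) * a + t * b) = (s - t) * (b - a) by ring.
rewrite normrM ler_piMr // /a /b /vpoint.
by case: asbool; case: asbool; rewrite /= ?subrr ?subr0 ?sub0r ?normrN ?normr0 ?normr1.
Qed.

Lemma path_edge_fst v w t : Defs.adjacent v w -> 0 <= t <= 1 ->
  path_length (bary t v w) (vpoint R v) t.
Proof.
move=> adj t01; apply: path_length_edge; exists v, w, t, 0; split=> //.
  by rewrite lexx ler01.
by rewrite bary0 subr0 ger0_norm //; case/andP: t01.
Qed.

Lemma path_edge_snd v w t : Defs.adjacent v w -> 0 <= t <= 1 ->
  path_length (bary t v w) (vpoint R w) (1 - t).
Proof.
move=> /adjacent_sym adj t01; rewrite bary_sym; apply: path_edge_fst => //.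
lra.
Qed.

Lemma path_edge_to v w t : Defs.adjacent v w -> 0 <= t <= 1 ->
  path_length (vpoint R v) (bary t v w) t.
Proof.
move=> adj t01; apply: path_length_edge; exists v, w, 0, t; split=> //.
  by rewrite lexx ler01.
by rewrite bary0 sub0r normrN ger0_norm //; case/andP: t01.
Qed.

Lemma path_adjacent v w : Defs.adjacent v w ->
  path_length (vpoint R v) (vpoint R w) 1.
Proof.
by move=> adj; rewrite -(bary1 R v w); apply: path_edge_to; rewrite // ler01 lexx.
Qed.

Lemma path_up (x : F) (i : int) (j : nat) :
  path_length (vpoint R (disc x i)) (vpoint R (disc x (i - j%:Z))) j%:R.
Proof.
elim: j => [|j IH]; first by rewrite subr0; exact: path_nil.
rewrite -natr1; apply: path_length_trans IH _; apply: path_adjacent.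
apply: adjacent_sym; have -> : i - j%:Z = i - j.+1%:Z + 1 by lia.
exact: adjacent_disc.
Qed.

Lemma path_down (x : F) (i : int) (j : nat) :
  path_length (vpoint R (disc x i)) (vpoint R (disc x (i + j%:Z))) j%:R.
Proof.
elim: j => [|j IH]; first by rewrite addr0; exact: path_nil.
rewrite -natr1; apply: path_length_trans IH _; apply: path_adjacent.
have -> : i + j.+1%:Z = i + j%:Z + 1 by lia.
exact: adjacent_disc.
Qed.

(** Both discs are enlarged until they coincide. Without a path [distT] would be the infimum of an
    empty set, which is 0, and [tdist] could fail to be positive. *)
Lemma vertices_connected v w : is_vertex v -> is_vertex w ->
  exists m, path_length (vpoint R v) (vpoint R w) m.
Proof.
move=> /(vertex_disc C)[x [i ->]] /(vertex_disc C)[y [j ->]].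
have [e xy] := ex_vge C (x - y).
pose k := Order.min e (Order.min i j).
have E : disc x k = disc y k.
  by apply/disc_eqP; split=> //; apply: vge_trans xy; rewrite /k ge_min lexx.
have ki : k <= i by rewrite /k !ge_min lexx orbT.
have kj : k <= j by rewrite /k !ge_min lexx !orbT.
have := path_up x i (absz (i - k)); have -> : i - (absz (i - k))%:Z = k by lia.
rewrite E => p1; have := path_down y k (absz (j - k)).
have -> : k + (absz (j - k))%:Z = j by lia.
by move/(path_length_trans p1) => p2; eexists; exact: p2.
Qed.

Lemma bary_fst v w t : v <> w -> bary t v w v = 1 - t.
Proof. by move=> vw; rewrite /bary vpoint_self vpoint_neq // mulr1 mulr0 addr0. Qed.

Lemma vertex_pointsE v : is_vertex v -> vertex_points (vpoint R v).
Proof. by exists v. Qed.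

Lemma bary_not_vertex v w t : Defs.adjacent v w -> 0 < t < 1 ->
  ~ vertex_points (bary t v w).
Proof.
move=> /(adjacent_neq C) vw t01 [u _ E].
have := congr1 (fun f => f v) E; rewrite bary_fst // /vpoint.
by case: asbool => /=; lra.
Qed.

Lemma tdist_vertex v : is_vertex v -> tdist (vpoint R v) = 1.
Proof. by move=> vv; rewrite /tdist asboolT //; exact: vertex_pointsE. Qed.

(** The coordinate at v is 1 - t here and 0 or 1 at a vertex, so every vertex is at distance at
    least min (t, 1 - t). *)
Lemma tdist_inner v w t : Defs.adjacent v w -> 0 < t < 1 ->
  [/\ 0 < tdist (bary t v w), tdist (bary t v w) <= t &
      tdist (bary t v w) <= 1 - t].
Proof.
move=> adj t01; have t01' : 0 <= t <= 1 by lra.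
have vv := adjacent_vertex adj; have vw := adjacent_vertex (adjacent_sym adj).
rewrite /tdist asboolF; last exact: bary_not_vertex.
split.
- apply: (@lt_le_trans _ _ (Order.min t (1 - t))); first by rewrite lt_min; lra.
  apply: lb_le_inf; first by eexists; exists (vpoint R v); [exact: vertex_pointsE|].
  move=> _ [_ [u vu <-] <-]; apply: lb_le_inf.
    have [m vm] := vertices_connected vv vu.
    by eexists; exact: path_length_trans (path_edge_fst adj t01') vm.
  move=> m /(coord_lipschitz v); rewrite (bary_fst _ (adjacent_neq C adj)).
  rewrite /vpoint ge_min; case: asbool => /= H; apply/orP; [left|right].
    by apply: le_trans H; rewrite -normrN; apply: le_trans (ler_norm _); lra.
  by apply: le_trans H; apply: le_trans (ler_norm _); lra.
- exact: dist_to_le (vertex_pointsE vv) (path_edge_fst adj t01').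
- exact: dist_to_le (vertex_pointsE vw) (path_edge_snd adj t01').
Qed.

End Distances.

Section FormIdentities.
Variable E : fieldType.
Implicit Types x y z : E.

(** Pullback of - dz / z under z |-> (z - x) / (y - z), with the coefficients written as [mobC] and
    [dmobC] produce them. *)
Lemma sform_id_finite x y z : z - x != 0 -> z - y != 0 ->
  (z - y)^-1 - (z - x)^-1 =
  (0 - ((1 * z + - x) / (- 1 * z + y) - 0)^-1) * ((y - x) / (- 1 * z + y) ^+ 2).
Proof.
move=> zx zy; have yz : y - z != 0 by rewrite -oppr_eq0 opprB.
have -> : - 1 * z + y = y - z by ring.
by rewrite mul1r subr0; field; rewrite zx zy yz.
Qed.

Lemma sform_id_infty x z : z - x != 0 ->
  0 - (z - x)^-1 =
  (0 - ((1 * z + - x) / (0 * z + 1) - 0)^-1) * (1 / (0 * z + 1) ^+ 2).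
Proof. by move=> zx; rewrite mul0r !add0r expr1n !divr1 mulr1 mul1r subr0. Qed.

Lemma sform_id_zero y z : z - y != 0 ->
  (z - y)^-1 - 0 =
  (0 - ((0 * z + 1) / (1 * z + - y) - 0)^-1) * (- 1 / (1 * z + - y) ^+ 2).
Proof. by move=> zy; rewrite mul0r !add0r mul1r !subr0; field; rewrite zy oner_neq0. Qed.

End FormIdentities.

(** * The building map and the order of - dz / z *)

Section BuildingMap.
Variables (R : realType) (K : finFieldType) (C : Cinfty R K).
Variables (lam : C -> tpoint R K) (hlam : is_building_map lam).
Local Notation F := (Finf K).
Local Notation disc := (@disc R K C).
Local Notation "x %:C" := (@emb R K C x) (at level 1, format "x %:C").
Implicit Types (z w : C) (s t : R) (g h : 'M[F]_2) (n : int) (a b : P1 K).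

Lemma lam_act g z : GL2 g -> Omega z -> lam (mobC g z) = actT g (lam z).
Proof. by case: hlam => _ + _; apply. Qed.

(** The affine map u |-> pi^n u + x carries the unit disc to x + pi^n O; this reduces to the fibres
    over the edge from v_0 to v_(-1), which the definition of the building map prescribes. *)
Lemma lam_nearest z (x : F) s n t : nearest z x s -> s = n%:~R + t ->
  0 <= t <= 1 -> lam z = bary t (disc x n) (disc x (n + 1)).
Proof.
move=> zx sE t01; have pi0 := piXz_neq0 K n; have pi0' := piXz_neq0 K (- n).
have one0 : (1 : F) != 0 := oner_neq0 _.
have := nearest_affine (- (piF K ^ (- n) * x)) pi0' zx.
rewrite addrN rord_piX mulrNz sE addrAC addrN add0r.
set z' := (_ + _ : C) => z't.
have z'E : mobC (mx2 (piF K ^ n) x 0 1) z' = z.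
  rewrite /mobC !mx2E rmorph0 mul0r add0r rmorph1 divr1 /z' rmorphN rmorphM /=.
  rewrite mulrDr mulrN !mulrA -rmorphM -expfzDr ?piF_neq0 // addrN expr0z rmorph1.
  by rewrite !mul1r subrK.
(* The fibres are prescribed for rational parameters only. *)
have [t' tE] := nearest_rat z't; rewrite tE in t01 z't *.
have t'01 : 0 <= t' <= 1 by rewrite -(ler0q R) -(ler_rat R t') rmorph1.
case: hlam => _ _ /(_ t' t'01 z')[_ fib].
have [] := fib; first by apply/(absi_fiberP _ z't); case: z't; rewrite rmorph0 subr0.
move=> Oz' lz'; have Gg : GL2 (mx2 (piF K ^ n) x 0 1).
  by rewrite /GL2 /= unitmx_mx2 mulr1 mulr0 subr0; exact: pi0.
rewrite -z'E (lam_act Gg Oz') lz' (actT_bary _ _ _ Gg) !(vstd_disc C).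
have pn : val_eq C (piF K ^ n / 1) n by rewrite divr1; exact: val_eq_piX.
rewrite !(actV_affine _ _ _ pi0 one0 pn) mulr0 add0r divr1.
by congr (bary _ (disc _ _) (disc _ _)); lia.
Qed.

Lemma lam_floor z (x : F) s : nearest z x s -> exists n t,
  [/\ s = n%:~R + t, 0 <= t < 1 & lam z = bary t (disc x n) (disc x (n + 1))].
Proof.
move=> zx; exists (Num.floor s), (s - (Num.floor s)%:~R).
have t01 : 0 <= s - (Num.floor s)%:~R < 1.
  have := Num.Theory.floor_itv s; rewrite intrD => /andP[? ?]; lra.
have sE : s = (Num.floor s)%:~R + (s - (Num.floor s)%:~R) by rewrite addrC subrK.
by split=> //; apply: lam_nearest zx sE _; lra.
Qed.

Definition order0 z := - logq K (absi z) - rord z.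

Lemma order0_nearest z x s : nearest z x s -> order0 z = s - rord z.
Proof. by move=> zx; rewrite /order0 (logq_absi zx) opprK. Qed.

Lemma Omega_neq0 z : Omega z -> z != 0.
Proof. by move=> Oz; have := Omega_subr_neq0 0 Oz; rewrite rmorph0 subr0. Qed.

Lemma order0_form z : Omega z ->
  ord_form 1 (sform (Some 0) None) z = (order0 z)%:E.
Proof.
move=> Oz; have [x [s zx]] := Omega_nearest Oz; have z0 := Omega_neq0 Oz.
rewrite (ord_form_nearest _ _ zx) (order0_nearest zx) mul1r.
rewrite /sform /inv_sub rmorph0 subr0 sub0r ordN ord_rord ?invr_eq0 //.
by rewrite rordV -EFinD addrC.
Qed.

Lemma order0_ge0 z : Omega z -> 0 <= order0 z.
Proof.
move=> Oz; have [x [s zx]] := Omega_nearest Oz; have z0 := Omega_neq0 Oz.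
rewrite (order0_nearest zx) subr_ge0 -lee_fin -ord_rord //.
by case: zx => _ /(_ 0); rewrite rmorph0 subr0.
Qed.

Lemma order0_eq0 z : Omega z -> order0 z = 0 -> geodesic (Some 0) None (lam z).
Proof.
move=> Oz; have [x [s zx]] := Omega_nearest Oz; have z0 := Omega_neq0 Oz.
rewrite (order0_nearest zx) => D0.
have z_0 : nearest z 0 s.
  case: zx => _ max; split=> //; rewrite rmorph0 subr0 ord_rord //.
  by congr (_%:E); lra.
have [n [t [_ t01 ->]]] := lam_floor z_0.
by apply: geodesic_std; lra.
Qed.

(** A positive order means that 0 is not a nearest point; then x has the same absolute value as z,
    so ord z is an integer k. *)
Lemma order0_gt0 z x s : nearest z x s -> 0 < order0 z ->
  exists2 k : int, order0 z = s - k%:~R & val_eq C x k.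
Proof.
move=> zx; have Oz := nearest_Omega zx; have z0 := Omega_neq0 Oz.
rewrite (order0_nearest zx) => D0.
have := ord_nearest 0 zx; rewrite rmorph0 !subr0 (ord_rord z0).
case: leP => [_ [E]|lt E]; first by move: D0; rewrite E subrr ltxx.
have [|k xk] := val_eq_ex C (x := x); first by rewrite -(emb_neq0 C) ord_finite // -E ltry.
by exists k => //; move: E; rewrite xk => -[->].
Qed.

(** The disc x + pi^s O is enlarged until its radius is |x|, when it contains 0. *)
Lemma order0_path z : Omega z -> exists2 y,
  geodesic (Some 0) None y & path_length (lam z) y (order0 z).
Proof.
move=> Oz; have [x [s zx]] := Omega_nearest Oz.
have := order0_ge0 Oz; rewrite le_eqVlt => /orP[/eqP D0|D0].
  exists (lam z); first exact: order0_eq0.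
  by rewrite -D0; exact: path_nil.
have [k DE xk] := order0_gt0 zx D0; have [n [t [sE t01 ->]]] := lam_floor zx.
have kn : k <= n.
  have : k%:~R < n%:~R + 1 :> R by lra.
  by rewrite -(intrD _ n 1) ltr_int; lia.
exists (vpoint R (disc x k)).
  have -> : disc x k = disc 0 k.
    by apply/disc_eqP; split=> //; rewrite subr0 (val_eq_vge _ xk).
  rewrite -(bary0 R _ (disc 0 (k + 1))); apply: geodesic_std; lra.
have -> : order0 z = t + (absz (n - k))%:R.
  have -> : (absz (n - k))%:R = (n - k)%:~R :> R.
    by rewrite pmulrn; congr (_ %:~R); lia.
  rewrite intrB; lra.
apply: path_length_trans (path_edge_fst (adjacent_disc C x n) _) _; first lra.
have := path_up C x n (absz (n - k)).
by have -> : n - (absz (n - k))%:Z = k by lia.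
Qed.

(** The order is t + (n - k) with n - k a nonnegative integer: at a vertex t = 0 and a positive
    integer is at least 1, and elsewhere t is the distance to one end of the edge. *)
Lemma tdist_le_order0 z : Omega z -> 0 < order0 z -> tdist (lam z) <= order0 z.
Proof.
move=> Oz D0; have [x [s zx]] := Omega_nearest Oz.
have [k DE _] := order0_gt0 zx D0; have [n [t [sE t01 ->]]] := lam_floor zx.
have DE' : order0 z = t + (n - k)%:~R by rewrite intrB; lra.
move: t01; rewrite le_eqVlt => /andP[/orP[/eqP t0|t0] t1].
  rewrite -t0 bary0 tdist_vertex; last exact: is_vertex_disc.
  rewrite DE' -t0 add0r -[1]/(1%:~R) ler_int.
  by move: D0; rewrite DE' -t0 add0r ltr0z; lia.
have [|_ le_t _] := tdist_inner C (adjacent_disc C x n) (t := t); first by rewrite t0.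
apply: le_trans le_t _; rewrite DE' lerDl ler0z.
have : 0 < (n - k + 1)%:~R :> R by rewrite intrD mulr1z; lra.
by rewrite ltr0z; lia.
Qed.

Lemma tdist_lam_gt0 z : Omega z -> 0 < tdist (lam z).
Proof.
move=> Oz; have [x [s zx]] := Omega_nearest Oz.
have [n [t [sE t01 ->]]] := lam_floor zx.
move: t01; rewrite le_eqVlt => /andP[/orP[/eqP <-|t0] t1].
  by rewrite bary0 tdist_vertex ?ltr01 //; exact: is_vertex_disc.
by have [|] := tdist_inner C (adjacent_disc C x n) (t := t); first by rewrite t0.
Qed.

Lemma order0_std_vertex z n : Omega z -> lam z = vpoint R (disc 0 n) ->
  order0 z = 0.
Proof.
move=> Oz; have [x [s zx]] := Omega_nearest Oz; have z0 := Omega_neq0 Oz.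
have [m [t [sE t01 ->]]] := lam_floor zx.
have mm := adjacent_neq C (adjacent_disc C x m) => /(congr1 (fun f => f (disc x m))).
(* The coordinate 1 - t at [disc x m] is positive, so this vertex is [disc 0 n] and t = 0; then 0 is
   a nearest point as well. *)
rewrite (bary_fst _ mm) /vpoint; case: asboolP => [/disc_eqP[mn xm]|_] /=; last by lra.
move=> t1; have t0 : t = 0 by lra.
have z_0 : nearest z 0 s.
  by apply: (nearest_change zx); rewrite sE t0 addr0.
rewrite (order0_nearest zx); case: z_0; rewrite rmorph0 subr0 (ord_rord z0).
by move=> [->]; rewrite subrr.
Qed.

Lemma mobP_transitive a : exists2 g, GL2 g & mobP g None = a.
Proof.
case: a => [x|].
  exists (mx2 x 1 1 0).
    by rewrite /GL2 /= unitmx_mx2 mulr0 mulr1 sub0r oppr_eq0 oner_neq0.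
  by rewrite /mobP !mx2E (negbTE (oner_neq0 _)) divr1.
exists 1%:M; first by rewrite /GL2 /= unitmx1.
by rewrite /mobP mxE /= eqxx.
Qed.

(** Every point is an image of infinity, so the case of infinity suffices. *)
Lemma mobP_comp g h a : GL2 g -> GL2 h -> mobP (g *m h) a = mobP g (mobP h a).
Proof.
move=> Gg Gh; have [k Gk <-] := mobP_transitive a.
rewrite -(mobP_infty_comp (GL2_mul Gg Gh) Gk) -mulmxA.
by rewrite (mobP_infty_comp Gg (GL2_mul Gh Gk)) (mobP_infty_comp Gh Gk).
Qed.

Lemma mobP1 a : mobP 1%:M a = a.
Proof.
case: a => [x|]; last by rewrite /mobP mxE /= eqxx.
rewrite /mobP !mxE /= mul0r add0r (negbTE (oner_neq0 _)) mul1r addr0.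
by rewrite divr1.
Qed.

Lemma mobPK g a : GL2 g -> mobP (invmx g) (mobP g a) = a.
Proof.
by move=> Gg; rewrite -(mobP_comp _ (GL2_inv Gg) Gg) (mulVmx Gg) mobP1.
Qed.

Lemma sform_normalize a b : a <> b -> exists h,
  [/\ GL2 h, mobP h a = Some 0, mobP h b = None &
   forall z : C, Omega z ->
     sform a b z = pullback1 h (sform (Some 0) None) z].
Proof.
case: a => [x|]; case: b => [y|] // ab.
- have yx : y - x != 0.
    by apply/eqP => /subr0_eq E; apply: ab; rewrite E.
  have det : \det (mx2 1 (- x) (- 1) y) = y - x.
    by rewrite det_mx2 mul1r mulrN1 opprK addrC.
  exists (mx2 1 (- x) (- 1) y); split.
  + by rewrite /GL2 /= unitmxE unitfE det.
  + by rewrite /mobP !mx2E mulN1r mul1r addrN mul0r addrC (negbTE yx).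
  + by rewrite /mobP !mx2E mulN1r addNr eqxx.
  + move=> z Oz; rewrite /pullback1 /dmobC det /mobC !mx2E /sform /inv_sub.
    rewrite rmorph0 !rmorphN rmorph1 rmorphB.
    exact: sform_id_finite (Omega_subr_neq0 x Oz) (Omega_subr_neq0 y Oz).
- exists (mx2 1 (- x) 0 1); split.
  + by rewrite /GL2 /= unitmx_mx2 mulr0 mulr1 subr0 oner_neq0.
  + rewrite /mobP !mx2E mul0r add0r (negbTE (oner_neq0 _)) mul1r addrN.
    by rewrite mul0r.
  + by rewrite /mobP !mx2E eqxx.
  + move=> z Oz; rewrite /pullback1 /dmobC det_mx2 /mobC !mx2E /sform /inv_sub.
    rewrite mulr1 mulr0 subr0 rmorph0 rmorphN rmorph1.
    exact: sform_id_infty (Omega_subr_neq0 x Oz).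
- exists (mx2 0 1 1 (- y)); split.
  + by rewrite /GL2 /= unitmx_mx2 mul0r mulr1 sub0r oppr_eq0 oner_neq0.
  + by rewrite /mobP !mx2E (negbTE (oner_neq0 _)) mul0r.
  + by rewrite /mobP !mx2E mul1r addrN eqxx.
  + have det : \det (mx2 0 1 1 (- y)) = - 1 by rewrite det_mx2 mul0r mulr1 sub0r.
    move=> z Oz; rewrite /pullback1 /dmobC det /mobC !mx2E /sform /inv_sub.
    rewrite rmorph0 !rmorphN rmorph1.
    exact: sform_id_zero (Omega_subr_neq0 y Oz).
Qed.

End BuildingMap.

(** * Unconditional sums in a complete ultrametric field *)

Section Sums.
Variables (R : realType) (K : finFieldType) (C : Cinfty R K).
Variables (I : choiceType).
Implicit Types (f : I -> C) (A B X : set I) (M : R) (e : \bar R).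

Lemma le_ord_fsum e A f : (forall i, A i -> (e <= ord (f i))%E) ->
  (e <= ord (\sum_(i \in A) f i))%E.
Proof.
move=> Ae; rewrite big_seq; apply: le_ord_sum => i.
(* A sum with infinite support is 0 by convention and satisfies any bound. *)
have [fin|inf] := pselect (finite_set (A `&` f @^-1` [set~ 0])).
  by rewrite in_finite_support // inE => -[/Ae].
by rewrite no_finite_support.
Qed.

Lemma fsum_subset A B f : finite_set B -> A `<=` B ->
  \sum_(i \in B) f i = \sum_(i \in A) f i + \sum_(i \in B `&` ~` A) f i.
Proof.
by move=> finB AB; rewrite (fsbigID A) // setIidr.
Qed.

(** Terms tending to 0 suffice: the sums over the finite sets of terms of order below n form a
    Cauchy sequence, since any larger finite set only adds terms of order at least n. *)
Lemma has_sum_ex X f :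
  (forall M, finite_set [set i | X i /\ ~ (M%:E <= ord (f i))%E]) ->
  exists s, has_sum X f s.
Proof.
move=> finX; pose A (n : nat) := [set i | X i /\ ~ (n%:R%:E <= ord (f i))%E].
have finA n : finite_set (A n) by exact: finX.
have AX n : A n `<=` X by move=> i [].
have outA n i : X i -> ~ A n i -> (n%:R%:E <= ord (f i))%E.
  by move=> Xi nA; apply: contrapT => nle; apply: nA.
have tail n B : finite_set B -> A n `<=` B -> B `<=` X ->
    (n%:R%:E <= ord (\sum_(i \in A n) f i - \sum_(i \in B) f i))%E.
  move=> finB AB BX; rewrite (fsum_subset _ finB AB) opprD addrA subrr add0r ordN.
  by apply: le_ord_fsum => i [Bi nAi]; apply: outA => //; exact: BX.
have A_mono m n : (m <= n)%N -> A m `<=` A n.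
  move=> mn i [Xi nle]; split=> // le; apply: nle; apply: le_trans le.
  by rewrite lee_fin ler_nat.
have [M|s sP] := @ord_complete _ _ C (fun n => \sum_(i \in A n) f i).
  exists (Num.bound `|M|) => m n Nm Nn.
  have MN : (M%:E <= (Num.bound `|M|)%:R%:E)%E.
    rewrite lee_fin; apply/ltW/(le_lt_trans (ler_norm _)).
    exact: archi_boundP (normr_ge0 _).
  apply: le_trans MN _; set N := Num.bound _ in Nm Nn *.
  rewrite -(subrKA (\sum_(i \in A N) f i)); apply: le_ordD.
    by rewrite ordBC; apply: tail => //; exact: A_mono.
  by apply: tail => //; exact: A_mono.
exists s => M; have [N HN] := sP M.
pose n := maxn N (Num.bound `|M|).
have Mn : (M%:E <= n%:R%:E)%E.
  rewrite lee_fin; apply/ltW/(le_lt_trans (ler_norm _)).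
  apply: lt_le_trans (archi_boundP (normr_ge0 _)) _.
  by rewrite ler_nat leq_maxr.
exists (A n); split=> // B finB AB BX.
rewrite -(subrKA (\sum_(i \in A n) f i)); apply: le_ordD.
  by rewrite ordBC; apply: HN; rewrite leq_maxl.
by apply: le_trans Mn _; exact: tail.
Qed.

Lemma has_sum_sum_over X f : (exists s, has_sum X f s) -> has_sum X f (sum_over X f).
Proof. exact: xgetPex. Qed.

Lemma has_sum_ge X f s M : has_sum X f s ->
  (forall i, X i -> (M%:E <= ord (f i))%E) -> (M%:E <= ord s)%E.
Proof.
move=> /(_ M)[A [finA AX sA]] XM.
rewrite -(subrK (\sum_(i \in A) f i) s); apply: le_ordD; first exact: sA.
by apply: le_ord_fsum => i /AX; exact: XM.
Qed.

(** A finite set approximating s up to order M' is enlarged by [i0]; this gives ord (s - f i0) >= M'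
    > M. *)
Lemma has_sum_dominant X f s (i0 : I) M M' : has_sum X f s -> X i0 -> M < M' ->
  ord (f i0) = M%:E -> (forall i, X i -> i <> i0 -> (M'%:E <= ord (f i))%E) ->
  ord s = M%:E.
Proof.
move=> /(_ M')[A [finA AX sA]] Xi0 MM' fi0 small.
have finB : finite_set (A `|` [set i0]) by rewrite finite_setU.
have AB : A `<=` A `|` [set i0] by move=> i; left.
have BX : A `|` [set i0] `<=` X by move=> i [/AX|->].
have := sA _ finB AB BX; set S := (\sum_(i \in _) _) => sS.
have SE : S = f i0 + \sum_(i \in (A `|` [set i0]) `&` ~` [set i0]) f i.
  have i0B : [set i0] `<=` A `|` [set i0] by move=> i; right.
  by rewrite /S (fsum_subset f finB i0B) fsbig_set1.
have rest : (M'%:E <= ord (s - f i0))%E.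
  have -> : s - f i0 = (s - S)
      + \sum_(i \in (A `|` [set i0]) `&` ~` [set i0]) f i.
    by rewrite SE opprD addrA subrK.
  by apply: le_ordD => //; apply: le_ord_fsum => i [/BX Xi ii0]; exact: small.
rewrite -fi0 -[s](subrK (f i0)) addrC; apply: ordDl_lt.
by rewrite fi0; apply: lt_le_trans rest; rewrite lte_fin.
Qed.

End Sums.

Section Products.
Variables (R : realType) (K : finFieldType) (C : Cinfty R K).

Lemma rord_prod_exp (r : nat) (k : 'I_r -> nat) (f : 'I_r -> C) :
  (forall i, f i != 0) ->
  \prod_i f i ^+ k i != 0 /\
  rord (\prod_i f i ^+ k i) = \sum_i (k i)%:R * rord (f i).
Proof.
move=> f0; elim/big_ind2: _ => [|x a y b [x0 xa] [y0 yb]|i _].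
- by rewrite oner_neq0 rord1.
- by rewrite mulf_neq0 // rordM // xa yb.
- by rewrite expf_neq0 // rordX.
Qed.

End Products.

Lemma size_artin_schreier (F : fieldType) (q : nat) : (1 < q)%N ->
  size ('X^q - 'X - 1 : {poly F}) = q.+1.
Proof.
move=> q1; rewrite -addrA size_polyDl size_polyXn // ltnS.
by rewrite -opprD size_polyN -polyC1 size_XaddC.
Qed.

(** * A point of C with residue outside K *)

Section Residue.
Variables (R : realType) (K : finFieldType) (C : Cinfty R K).
Local Notation F := (Finf K).
Local Notation disc := (@disc R K C).
Local Notation "x %:C" := (@emb R K C x) (at level 1, format "x %:C").

(** x - y divides x^n - y^n with an integral cofactor. *)
Lemma rord_ge0_sum_exp (n : nat) (x y : C) :
  (0 <= ord x)%E -> (0 <= ord y)%E ->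
  (ord (x - y) <= ord (x ^+ n - y ^+ n))%E.
Proof.
move=> x0 y0; have ge0X (z : C) m : (0 <= ord z)%E -> (0 <= ord (z ^+ m))%E.
  move=> z0; elim: m => [|m IH]; first by rewrite expr0 ord_one.
  by rewrite exprS ordM adde_ge0.
rewrite subrXX ordM leeDl //; apply: le_ord_sum => i _.
by rewrite ordM adde_ge0 // ge0X.
Qed.

(* The residue field of C is infinite: a root of X^q - X - 1 is not congruent
   to any element of the residue field of F, where X^q = X. *)
Lemma nearest_unit_ex : exists z : C, nearest z 0 0.
Proof.
pose q := #|{: K}|; have q1 : (1 < q)%N := card_finNzRing_gt1 K.
pose p := 'X^q - 'X - 1 : {poly F}.
have sp : (1 < size p)%N by rewrite size_artin_schreier // ltnS ltnW.
have [||z _] := @alg_closed _ _ C (map_poly (emb C) p).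
- by rewrite size_map_poly.
- by move=> i; rewrite coef_map; exact: algebraic_id.
rewrite rootE /p !rmorphB /= map_polyXn map_polyX rmorph1 !hornerE.
rewrite subr_eq0 => /eqP zq; exists z.
have z0 : z != 0.
  apply: contra_eq_neq zq => ->; rewrite expr0n subr0 eqn0Ngt (ltnW q1) /=.
  by rewrite eq_sym oner_neq0.
have zE : z ^+ q = z + 1 by rewrite -zq addrC subrK.
(* A negative order would satisfy q ord z = ord (z + 1) = ord z. *)
have z_ge0 : (0 <= ord z)%E.
  rewrite leNgt; apply/negP => zlt; have zlt' : rord z < 0.
    by rewrite -lte_fin -ord_rord.
  have E : ord (z + 1) = ord z by apply: ordDl_lt; rewrite ord_one.
  have : rord (z ^+ q) = rord z by rewrite /rord zE E.
  rewrite rordX; have : 1 < q%:R :> R by rewrite ltr1n.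
  by move: zlt'; nra.
have max (y : F) : (ord (z - y%:C) <= 0)%E.
  rewrite leNgt; apply/negP => zy.
  have y0 : (0 <= ord y%:C)%E.
    by rewrite -(subKr z y%:C); apply: le_ordD => //; rewrite ordN ltW.
  have [f _ fy] : Oinf y by apply/(OinfE C).
  (* The constant congruent to y satisfies c^q = c. *)
  pose c := ps_const (pcoef f 0).
  have cq : (ps_to_F c)%:C ^+ q = (ps_to_F c)%:C.
    by rewrite -rmorphXn /= /ps_to_F -tofracXn -ps_constX finfield.expf_card.
  have c0 : (0 <= ord (ps_to_F c)%:C)%E by apply/(OinfE C); exists c.
  have fc : (1%:R%:E <= ord (ps_to_F (f - c)%R)%:C)%E.
    by apply/ord_ge_coef => -[|//] _ /=; exact: subrr.
  have zc : (0 < ord (z - (ps_to_F c)%:C))%E.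
    have -> : z - (ps_to_F c)%:C = (z - y%:C) + (ps_to_F (f - c))%:C.
      by rewrite /ps_to_F tofracB -!/(ps_to_F _) fy rmorphB addrA subrK.
    apply: (@lt_le_trans _ _ (Order.min (ord (z - y%:C)) 1%:R%:E)).
      by rewrite lt_min zy lte_fin ltr01.
    apply: le_ordD; rewrite ge_min; first by rewrite lexx.
    by rewrite fc orbT.
  (* 1 = (z^q - c^q) - (z - c) would have positive order. *)
  have : (0 < ord (1 : C))%E.
    have -> : (1 : C) = (z ^+ q - (ps_to_F c)%:C ^+ q) + - (z - (ps_to_F c)%:C).
      by rewrite cq -zq opprB addrA subrK.
    apply: lt_le_trans zc _; apply: le_ordD; last by rewrite ordN.
    exact: rord_ge0_sum_exp.
  by rewrite ord_one ltxx.
split=> //; apply/eqP; rewrite eq_le max rmorph0 subr0 //.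
Qed.

End Residue.

(** * Nonempty fibres and invariance of [tdist] *)

Section Fibers.
Variables (R : realType) (K : finFieldType) (C : Cinfty R K).
Variables (lam : C -> tpoint R K) (hlam : is_building_map lam).
Local Notation F := (Finf K).
Local Notation disc := (@disc R K C).
Local Notation "x %:C" := (@emb R K C x) (at level 1, format "x %:C").

(** The point pi^n z0 + x lies over [disc x n], where z0 is at distance 1 from F, attained at 0. *)
Lemma vertex_fiber_ex v : is_vertex v ->
  exists2 z : C, Omega z & lam z = vpoint R v.
Proof.
move=> /(vertex_disc C)[x [n ->]]; have [z0 z00] := nearest_unit_ex C.
have := nearest_affine x (piXz_neq0 K n) z00.
rewrite rord_piX add0r mulr0 add0r; set z := (_ + _ : C) => zx.
exists z; first exact: nearest_Omega zx.
rewrite (lam_nearest hlam (n := n) (t := 0) zx) ?addr0 ?bary0 //.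
by rewrite lexx ler01.
Qed.

Lemma actTK g (p : tpoint R K) : GL2 g -> actT (invmx g) (actT g p) = p.
Proof.
by move=> Gg; apply/funext => u; rewrite /actT invmxK actVK.
Qed.

Lemma vertex_points_act g (p : tpoint R K) : GL2 g ->
  vertex_points (actT g p) <-> vertex_points p.
Proof.
move=> Gg; split=> -[v vv E].
  exists (actV (invmx g) v); first exact: is_vertex_act (GL2_inv Gg) vv.
  by rewrite -(actT_vpoint R _ (GL2_inv Gg)) E actTK.
exists (actV g v); first exact: is_vertex_act Gg vv.
by rewrite -(actT_vpoint R _ Gg) E.
Qed.

Lemma distT_act g (p p' : tpoint R K) : GL2 g ->
  distT (actT g p) (actT g p') = distT p p'.
Proof.
move=> Gg; rewrite /distT; congr inf; apply/seteqP; split=> m.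
  by move/(path_length_act (GL2_inv Gg)); rewrite !actTK.
exact: path_length_act.
Qed.

Lemma tdist_act g (p : tpoint R K) : GL2 g -> tdist (actT g p) = tdist p.
Proof.
move=> Gg; have GVi := GL2_inv Gg.
rewrite /tdist; have -> : `[< vertex_points (actT g p) >] = `[< vertex_points p >].
  exact/asbool_equiv_eq/vertex_points_act.
case: ifP => // _; rewrite /dist_to; congr inf; apply/seteqP; split=> _ [y vy <-].
  exists (actT (invmx g) y); first exact/vertex_points_act.
  by rewrite -{1}(actTK p Gg) (distT_act _ _ GVi).
exists (actT g y); first exact/vertex_points_act.
exact: distT_act.
Qed.

End Fibers.

(** * Orders of s(z;a,b) and of the terms of the series *)

Section GeodesicOrder.
Variables (R : realType) (K : finFieldType) (C : Cinfty R K).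
Variables (lam : C -> tpoint R K) (hlam : is_building_map lam).
Local Notation F := (Finf K).
Local Notation disc := (@disc R K C).
Local Notation "x %:C" := (@emb R K C x) (at level 1, format "x %:C").
Implicit Types (z w : C) (g h : 'M[F]_2) (a b : P1 K).

Definition sform_order a b z : R := fine (ord_form 1 (sform a b) z).

Lemma sform_order_normalize a b : a <> b -> exists h,
  [/\ GL2 h, mobP h a = Some 0, mobP h b = None &
   forall z, Omega z ->
     ord_form 1 (sform a b) z = (order0 (mobC h z))%:E].
Proof.
move=> /(sform_normalize C)[h [Gh ha hb sE]]; exists h; split=> // z Oz.
rewrite -(order0_form (mobC_Omega Gh Oz)) -(ord_form_pullback1 _ Gh Oz).
by rewrite /ord_form sE.
Qed.

Lemma sform_orderE a b z : a <> b -> Omega z ->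
  ord_form 1 (sform a b) z = (sform_order a b z)%:E.
Proof.
move=> /sform_order_normalize[h [_ _ _ sE]] Oz.
by rewrite /sform_order sE.
Qed.

Lemma sform_order_ge0 a b z : a <> b -> Omega z -> 0 <= sform_order a b z.
Proof.
move=> /sform_order_normalize[h [Gh _ _ sE]] Oz.
by rewrite /sform_order sE // order0_ge0 //; exact: mobC_Omega.
Qed.

Lemma geodesic_pull h a b p : GL2 h -> mobP h a = Some 0 -> mobP h b = None ->
  geodesic (Some 0) None (actT h p) -> geodesic a b (p : tpoint R K).
Proof.
move=> Gh ha hb /(geodesic_act (GL2_inv Gh)); rewrite -ha -hb actTK //.
by rewrite !mobPK.
Qed.

Lemma sform_order_eq0 a b z : a <> b -> Omega z -> sform_order a b z = 0 ->
  geodesic a b (lam z).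
Proof.
move=> /sform_order_normalize[h [Gh ha hb sE]] Oz; rewrite /sform_order sE //=.
move/(order0_eq0 hlam (mobC_Omega Gh Oz)); rewrite (lam_act hlam Gh Oz).
exact: geodesic_pull.
Qed.

Lemma tdist_le_sform_order a b z : a <> b -> Omega z -> 0 < sform_order a b z ->
  tdist (lam z) <= sform_order a b z.
Proof.
move=> /sform_order_normalize[h [Gh ha hb sE]] Oz; rewrite /sform_order sE //=.
move/(tdist_le_order0 hlam (mobC_Omega Gh Oz)).
by rewrite (lam_act hlam Gh Oz) tdist_act.
Qed.

Lemma sform_order_path a b z : a <> b -> Omega z -> exists2 y,
  geodesic a b y & path_length (lam z) y (sform_order a b z).
Proof.
move=> /sform_order_normalize[h [Gh ha hb sE]] Oz; rewrite /sform_order sE //=.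
have [y gy py] := order0_path hlam (mobC_Omega Gh Oz).
have Gi := GL2_inv Gh; exists (actT (invmx h) y).
  by apply: geodesic_pull Gh ha hb _; rewrite -{1}[h]invmxK actTK.
by have := path_length_act Gi py; rewrite (lam_act hlam Gh Oz) actTK.
Qed.

Lemma sform_order_vertex a b z v : a <> b -> Omega z -> lam z = vpoint R v ->
  geodesic a b (vpoint R v) -> sform_order a b z = 0.
Proof.
move=> /sform_order_normalize[h [Gh ha hb sE]] Oz lz.
move/(geodesic_act Gh); rewrite ha hb (actT_vpoint _ _ Gh).
move=> /(geodesic_std_vertex C)[n hv].
rewrite /sform_order sE //=.
apply: (order0_std_vertex hlam (n := n) (mobC_Omega Gh Oz)).
by rewrite (lam_act hlam Gh Oz) lz (actT_vpoint _ _ Gh) hv.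
Qed.

(** Each factor has the order of its 1-form minus s, the correction by |z|_i, and the power of the
    unit det g contributes 0. *)
Lemma poincare_term_order (r : nat) (k : 'I_r -> nat) (l : int)
    (a b : 'I_r -> P1 K) g z (x : F) (s : R) :
  GL2 g -> ord (\det g)%:C = 0%E -> (forall i, a i <> b i) -> nearest z x s ->
  ord (poincare_term k l a b g z) =
    (\sum_i (k i)%:R * sform_order (a i) (b i) (mobC g z)
     - (\sum_i k i)%N%:R * s)%:E.
Proof.
move=> Gg dg ab zx; have Oz := nearest_Omega zx; have Og := mobC_Omega Gg Oz.
pose f i := pullback1 g (sform (a i) (b i)) z.
have fE i : ord (f i) = (sform_order (a i) (b i) (mobC g z) - s)%:E.
  have := ord_form_pullback1 (sform (a i) (b i)) Gg Oz.
  rewrite (sform_orderE (ab i) Og) (ord_form_nearest _ _ zx) mul1r -/(f i).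
  have nN := @ord_neqNy _ _ _ (f i).
  by case: (ord (f i)) nN => [u||] //= _ [<-]; rewrite addrK.
have f0 i : f i != 0 by apply: ord_finite; rewrite fE ltry.
have [P0 PE] := rord_prod_exp k f0.
have d0 : (\det g)%:C != 0 by apply: ord_finite; rewrite dg ltry.
rewrite /poincare_term ord_rord ?mulf_neq0 ?expfz_neq0 //; congr (_%:E).
rewrite rordM ?expfz_neq0 // rordXz // /rord dg /= mulr0 add0r -/(rord _) PE.
rewrite natr_sum mulr_suml -sumrB; apply: eq_bigr => i _.
by rewrite /rord fE /= mulrBr.
Qed.

End GeodesicOrder.

Lemma weighted_sum_ge (R : realType) (r : nat) (k : 'I_r -> nat) (d : 'I_r -> R)
    (i : 'I_r) : (forall i, (0 < k i)%N) -> (forall i, 0 <= d i) ->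
  d i <= \sum_i (k i)%:R * d i.
Proof.
move=> k0 d0; rewrite (bigD1 i) //= -[leLHS]addr0; apply: lerD.
  by rewrite ler_peMl // ler1n.
by apply: sumr_ge0 => j _; rewrite mulr_ge0.
Qed.

Lemma vpoint_inj (R : realType) (K : finFieldType) (u v : vclass K) :
  vpoint R u = vpoint R v -> u = v.
Proof.
move/(congr1 (fun f => f u)); rewrite /vpoint asboolT //.
by case: asboolP => //= _ /eqP; rewrite oner_eq0.
Qed.

(** * Cosets and their representatives *)

Section Cosets.
Variable K : finFieldType.
Variables G H : set 'M[Finf K]_2.
Hypotheses (G_group : is_subgroup G) (H_group : is_subgroup H) (HG : H `<=` G).
Implicit Types g h : 'M[Finf K]_2.

Lemma right_coset_self g : right_coset H g g.
Proof. by case: H_group => _ H1 _ _; exists 1%:M; rewrite // mul1mx. Qed.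

Lemma right_coset_mul h g : H h -> right_coset H (h *m g) = right_coset H g.
Proof.
move=> Hh; have [HGL _ HM HV] := H_group.
apply/seteqP; split=> _ [h' Hh' <-].
  by exists (h' *m h); [exact: HM|rewrite mulmxA].
exists (h' *m invmx h); first by apply: HM => //; exact: HV.
by rewrite mulmxA (mulmxKV (HGL _ Hh)).
Qed.

Lemma coset_repr (c : set 'M[Finf K]_2) (c0 : (right_coset H @` G) c) :
  G (xget 1%:M c) /\ c = right_coset H (xget 1%:M c).
Proof.
case: c0 => g Gg cE; have [_ _ GM _] := G_group.
have cg : c g by rewrite -cE; exact: right_coset_self.
(* The coset contains [g], so [xget] returns a member and not its default. *)
have : right_coset H g (xget 1%:M c) by rewrite cE; exact: xgetI cg.
move=> [h Hh <-]; split; first by apply: GM => //; exact: HG.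
by rewrite (right_coset_mul _ Hh).
Qed.

Lemma coset_repr_mul g : exists2 h, H h & xget 1%:M (right_coset H g) = h *m g.
Proof.
have := xgetI 1%:M (right_coset_self g) => -[h Hh hE].
by exists h.
Qed.

End Cosets.

Theorem theorem3p3p1 (R : realType) (K : finFieldType) (hq : odd #|{: K}|)
  (C : Cinfty R K)
  (lam : C -> tpoint R K) (hlam : is_building_map lam)
  (G H : set 'M[Finf K]_2)
  (G_group : is_subgroup G) (G_discrete : is_discrete C G)
  (G_det : forall g, G g -> Oinf_units (\det g))
  (r : nat) (hr : (2 <= r)%N) (k : 'I_r -> nat) (l : int)
  (a b : 'I_r -> P1 K) (data : poincare_data G H k l a b)
  (hP : condition_P R G H a b)
  (v : vclass K) (hv : is_vertex v)
  (h_inter : \bigcap_(i in [set: 'I_r]) geodesic (a i) (b i) = [set vpoint R v])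
  (h_stab : [set g | G g /\ actV g v = v] `<=` H) :
  let P := @poincare R K C G H r k l a b in
  let ordP := ord_form (\sum_(i < r) k i)%N P in
  let orbit := [set mobC g w | g in G
                 & w in [set w : C | Omega w /\ lam w = vpoint R v]] in
  [/\ forall z : C, Omega z -> orbit z -> ordP z = 0%E,
      forall z : C, Omega z -> ~ orbit z ->
        ((tdist (lam z))%:E <= ordP z)%E /\ 0 < tdist (lam z) &
      exists2 z : C, Omega z & P z <> 0].
Proof.
move=> P ordP orbit.
have [k0 [H_group HG] _ [ab _] Hfix] := data.
have [GGL G1 GM GV] := G_group.
pose f (z : C) (c : set 'M[Finf K]_2) := poincare_term k l a b (xget 1%:M c) z : C.
pose X := right_coset H @` G.
pose D i (z : C) := sform_order (a i) (b i) z.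
have D_ge0 i z : Omega z -> 0 <= D i z by move=> Oz; exact: sform_order_ge0 (ab i) Oz.
have repr c : X c -> G (xget 1%:M c) /\ c = right_coset H (xget 1%:M c).
  exact: coset_repr.
have fE z x s c : nearest z x s -> X c -> ord (f z c) =
    (\sum_i (k i)%:R * D i (mobC (xget 1%:M c) z) - (\sum_i k i)%N%:R * s)%:E.
  move=> zx /repr[Gc _]; apply: (poincare_term_order k l (GGL _ Gc) _ ab zx).
  by have [u uu <-] := G_det _ Gc; exact: ord_unit.
have all0 (w : C) : Omega w -> (forall i, D i w = 0) -> lam w = vpoint R v.
  move=> Ow Dw; suff : (\bigcap_(i in [set: 'I_r]) geodesic (a i) (b i)) (lam w).
    by rewrite h_inter.
  by move=> i _; exact: (sform_order_eq0 hlam (ab i) Ow (Dw i)).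
(* Off [v] some [D i z] is positive; as k i >= 1, this single term already gives the bound. *)
have off_vertex z : Omega z -> lam z <> vpoint R v ->
    tdist (lam z) <= \sum_i (k i)%:R * D i z.
  move=> Oz nv; have [i Di] : exists i, D i z <> 0.
    by apply: contrapT => nD; apply: nv; apply: all0 => // i;
      apply: contrapT => Di; apply: nD; exists i.
  apply: (@le_trans _ _ (D i z)); last by apply: weighted_sum_ge => // j; exact: D_ge0.
  apply: (tdist_le_sform_order hlam (ab i) Oz); rewrite lt_neqAle D_ge0 // andbT eq_sym.
  exact/eqP.
have summable z : Omega z -> has_sum X (f z) (P z).
  move=> Oz; apply: has_sum_sum_over; apply: has_sum_ex => M.
  have [x [s zx]] := Omega_nearest Oz.
  have [n [t [_ t01 lz]]] := lam_floor hlam zx.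
  have u01 : 0 <= t <= 1 by lra.
  (* A term of order below M has every [D i] below B - 1. Condition (P) concerns vertices, so
     [lam z] is replaced by the vertex [disc C x n] of its edge, at distance at most 1; hence the
     summand 1. *)
  pose B := M + (\sum_i k i)%N%:R * s + 1.
  apply: sub_finite_set (hP (disc C x n) (Num.bound `|B|) (is_vertex_disc C x n)).
  move=> c [Xc small]; have [Gc cE] := repr c Xc.
  exists (xget 1%:M c); last exact/esym.
  split=> // i; set g := xget _ _ in cE Gc *; have Gg := GGL _ Gc.
  have Og := mobC_Omega Gg Oz.
  have [y gy py] := sform_order_path hlam (ab i) Og.
  have := path_length_act Gg (path_edge_to (adjacent_disc C x n) u01).
  rewrite (actT_vpoint _ _ Gg) -lz -(lam_act hlam Gg Oz) => /path_length_trans-/(_ _ _ py).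
  move/(dist_to_le gy) => dle; apply: le_trans dle _.
  apply: ltW; apply: le_lt_trans (archi_boundP (normr_ge0 B)).
  apply: le_trans (ler_norm _).
  have Dle : D i (mobC g z) <= \sum_i (k i)%:R * D i (mobC g z).
    by apply: weighted_sum_ge => // j; exact: D_ge0.
  move/negP: small; rewrite (fE _ _ _ _ zx Xc) lee_fin -ltNge -/g.
  rewrite -/(D i (mobC g z)) /B; lra.
have ordPE z x s : nearest z x s ->
    ordP z = (ord (P z) + ((\sum_i k i)%N%:R * s)%:E)%E.
  exact: ord_form_nearest.
have partA z : Omega z -> orbit z -> ordP z = 0%E.
  move=> Oz [g Gg [w [Ow lw] zE]]; have [x [s zx]] := Omega_nearest Oz.
  have GLg := GGL _ Gg; have GLi := GL2_inv GLg.
  have lam_mob g' : GL2 g' -> lam (mobC g' z) = vpoint R (actV (g' *m g) v).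
    move=> Gg'; rewrite (lam_act hlam Gg' Oz) -zE (lam_act hlam GLg Ow) lw.
    by rewrite (actT_vpoint R _ GLg) (actT_vpoint R _ Gg') (actV_comp _ Gg' GLg).
  (* The dominant term is that of the coset of g^-1, with chosen representative h0 g^-1. *)
  have [h0 Hh0 c0E] := coset_repr_mul H_group (invmx g).
  rewrite (ordPE _ _ _ zx); set c0 := right_coset H (invmx g) in c0E.
  have Xc0 : X c0 by exists (invmx g) => //; exact: GV.
  have GLh0 : GL2 h0 by apply/GGL/HG.
  (* h0 fixes all a_i and b_i, so it preserves each geodesic and hence their only common point. *)
  have fix_v : vpoint R (actV h0 v) = vpoint R v.
    suff : (\bigcap_(i in [set: 'I_r]) geodesic (a i) (b i)) (vpoint R (actV h0 v)).
      by rewrite h_inter.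
    move=> i _; have [<- <-] := Hfix _ Hh0 i; rewrite -(actT_vpoint R _ GLh0).
    apply: (geodesic_act GLh0).
    suff : (\bigcap_(i in [set: 'I_r]) geodesic (a i) (b i)) (vpoint R v) by apply.
    by rewrite h_inter.
  suff -> : ord (P z) = (- ((\sum_i k i)%N%:R * s))%:E by rewrite -EFinD addNr.
  apply: (has_sum_dominant (summable z Oz) Xc0 (M' := 1 - (\sum_i k i)%N%:R * s)).
  - lra.
  - rewrite (fE _ _ _ _ zx Xc0) c0E big1 ?sub0r // => i _.
    have GL0 := GL2_mul GLh0 GLi.
    rewrite /D (sform_order_vertex hlam (ab i) (mobC_Omega GL0 Oz) (v := v)).
    + exact: mulr0.
    + by rewrite (lam_mob _ GL0) -mulmxA (mulVmx GLg) mulmx1.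
    + suff : (\bigcap_(i in [set: 'I_r]) geodesic (a i) (b i)) (vpoint R v) by apply.
      by rewrite h_inter.
  (* Any other representative takes [lam z] to a vertex different from [v], because the stabilizer
     of [v] lies in H; there [tdist] is 1, which explains the choice of M'. *)
  - move=> c Xc cc0; have [Gc cE] := repr c Xc.
    rewrite (fE _ _ _ _ zx Xc) lee_fin lerD2r.
    set g' := xget _ _ in Gc cE *; have GL' := GGL _ Gc.
    have Og' := mobC_Omega GL' Oz.
    have vg' := is_vertex_act (GL2_mul GL' GLg) hv.
    have := off_vertex _ Og'; rewrite (lam_mob _ GL') (tdist_vertex R vg'); apply.
    move/vpoint_inj => fixv; apply: cc0; rewrite cE.
    have Hg'g : H (g' *m g) by apply: h_stab; split=> //; exact: GM.
    by rewrite /c0 -(right_coset_mul H_group (invmx g) Hg'g) (mulmxK GLg).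
split=> //.
- move=> z Oz norb; split; last exact: (tdist_lam_gt0 hlam Oz).
  have [x [s zx]] := Omega_nearest Oz; rewrite (ordPE _ _ _ zx).
  suff : ((tdist (lam z) - (\sum_i k i)%N%:R * s)%:E <= ord (P z))%E.
    by rewrite EFinB leeBlDr.
  apply: has_sum_ge (summable z Oz) _ => c Xc; have [Gc cE] := repr c Xc.
  rewrite (fE _ _ _ _ zx Xc) lee_fin lerD2r.
  set g := xget _ _ in Gc cE *; have GLg := GGL _ Gc; have Og := mobC_Omega GLg Oz.
  (* Invariance of [tdist] makes the bound the same for all terms. *)
  have tE : tdist (lam (mobC g z)) = tdist (lam z).
    by rewrite (lam_act hlam GLg Oz) (tdist_act _ GLg).
  have := off_vertex _ Og; rewrite tE.
  apply => lv; apply: norb.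
  exists (invmx g); first exact: GV.
  exists (mobC g z); last exact: mobCK GLg Oz.
  by split; [exact: Og|exact: lv].
- have [z Oz lz] := vertex_fiber_ex hlam hv.
  (* Over [v] the order is 0, while at a zero of P it would be +oo. *)
  exists z => // Pz0; have [x [s zx]] := Omega_nearest Oz.
  have : ordP z = 0%E.
    by apply: partA => //; exists 1%:M; [exact: G1|exists z; [|exact: mobC1]].
  by rewrite (ordPE _ _ _ zx) Pz0 ord_zero addye.
Qed.
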